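(* Let $\mathfrak{T}$ be any task and $\gamma>0$. Then, for any sufficiently small $\varepsilon,\delta>0$ and any $m\in\mathbb{N}$, there exists $\delta' = \Theta\left(\delta\cdot\frac{\varepsilon}{m\log(1/\delta)}\right)$ such that \[ n^{\mathfrak{T}}_m(\varepsilon,\delta;\gamma-o(1)) \le \tilde{O}\left(\frac{\log(1/\delta)}{\varepsilon} + \frac{1}{\sqrt{m}}\cdot\frac{\log(1/\delta)^{1.5}}{\varepsilon}\cdot n^{\mathfrak{T}}_1(\varepsilon,\delta';\gamma)\right). \]
   Context: Let $\mathcal{Z}$ be a sample domain and $\mathcal{O}$ a finite output set. In the user-level setting there are $n$ users, each holding $m$ examples; the input is $\mathbf{x}\in\mathcal{Z}^{nm}$. Two inputs are user-level neighbors if they differ only in the data of a single user. A randomized algorithm $\mathbf{A}$ is $(\varepsilon,\delta)$-user-level DP if for all user-level neighbors $\mathbf{x},\mathbf{x}'$ and all $S\subseteq\mathcal{O}$, $\Pr[\mathbf{A}(\mathbf{x})\in S]\le e^{\varepsilon}\Pr[\mathbf{A}(\mathbf{x}')\in S]+\delta$; when $m=1$ it is called item-level DP. A task $\mathfrak{T}$ specifies, for every valid distribution $\mathcal{D}$ over $\mathcal{Z}$, a set $\Psi_{\mathfrak{T}}(\mathcal{D})\subseteq\mathcal{O}$ of correct answers; an algorithm on $nm$ samples is $\gamma$-useful if $\Pr_{\mathbf{x}\sim\mathcal{D}^{nm}}[\mathbf{A}(\mathbf{x})\in\Psi_{\mathfrak{T}}(\mathcal{D})]\ge\gamma$ for every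 valid $\mathcal{D}$. $n^{\mathfrak{T}}_m(\varepsilon,\delta;\gamma)$ denotes the smallest number $n$ of users such that some $(\varepsilon,\delta)$-user-level DP algorithm with $n$ users of $m$ examples each is $\gamma$-useful for $\mathfrak{T}$. $\tilde{O}$ hides polylogarithmic factors. ''Sufficiently small'' means at most some implicit absolute constant. *)

(* Defs.v *)
From HB Require Import structures.
From mathcomp Require Import all_boot all_order all_algebra.
From mathcomp Require Import all_classical all_reals all_analysis.

Set Implicit Arguments.
Unset Strict Implicit.
Unset Printing Implicit Defensive.

Import Order.TTheory GRing.Theory Num.Theory.
Import numFieldNormedType.Exports.

Local Open Scope classical_set_scope.
Local Open Scope ring_scope.

Section iid.
Context (d : measure_display) (Z : measurableType d) (R : realType).

Definition cons_pair (n : nat) (p : Z * n.-tuple Z) : n.+1.-tuple Z :=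
  [tuple of p.1 :: p.2].

Lemma measurable_cons_pair (n : nat) :
  measurable_fun [set: Z * n.-tuple Z] (@cons_pair n).
Proof. exact: measurable_cons. Qed.

HB.instance Definition _ (n : nat) := @isMeasurableFun.Build _ _ _ _
  (@cons_pair n) (@measurable_cons_pair n).

(* The n-fold product measure D^n; [iid_box] is its defining property. *)
Fixpoint iid (D : probability Z R) (n : nat) : probability (n.-tuple Z) R :=
  match n with
  | 0 => dirac [tuple]
  | n'.+1 => distribution (D \x iid D n')%E (@cons_pair n')
  end.

Lemma measurable_box (n : nat) (A : 'I_n -> set Z) :
  (forall i, measurable (A i)) ->
  measurable [set x : n.-tuple Z | forall i, A i (tnth x i)].
Proof.
move=> mA.
rewrite (_ : [set _ | _] = \big[setI/setT]_(i < n) ((@tnth n Z)^~ i @^-1` A i)).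
  apply: bigsetI_measurable => i _.
  by rewrite -[X in measurable X]setTI; exact: measurable_tnth.
rewrite -bigcap_seq; apply/seteqP; split => x /= Ax i; first by move=> _; exact: Ax.
by apply: (Ax i); rewrite /= mem_index_enum.
Qed.

Lemma iid_box (D : probability Z R) (n : nat) (A : 'I_n -> set Z) :
  (forall i, measurable (A i)) ->
  iid D n [set x | forall i, A i (tnth x i)] = (\prod_(i < n) D (A i))%E.
Proof.
elim: n A => [|n IH] A mA.
  by rewrite big_ord0 /= diracE mem_set//= => -[].
have mB : measurable
    [set x : n.-tuple Z | forall i, A (lift ord0 i) (tnth x i)].
  by apply: (@measurable_box n (fun i => A (lift ord0 i))) => i; exact: mA.
rewrite big_ord_recl -IH//= /distribution /pushforward /=.
rewrite -(product_measure1E D (iid D n) (mA ord0) mB).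
congr (product_measure1 _ _ _); apply/seteqP; split => -[z x] /=.
  move=> Ax; split; first by have := Ax ord0; rewrite tnth0.
  by move=> i; have := Ax (lift ord0 i); rewrite tnthS.
move=> [Az Ax] i; case: (unliftP ord0 i) => [j ->|->]; last by rewrite tnth0.
by rewrite tnthS.
Qed.

End iid.

Section tasks_and_algorithms.
Context (d : measure_display) (Z : measurableType d) (O : finType) (R : realType).

Record task := Task {
  valid : set (probability Z R) ;
  correct : probability Z R -> {set O}
}.

(* A randomized algorithm with finite output set, as a Markov kernel given by
   its output probabilities [A x o] = Pr[A(x) = o]. *)
Record algorithm (N : nat) := Algorithm {
  out_prob :> N.-tuple Z -> O -> R ;
  out_prob_ge0 : forall x o, 0 <= out_prob x o ;
  out_prob_sum1 : forall x, \sum_o out_prob x o = 1 ;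
  measurable_out_prob : forall o, measurable_fun [set: N.-tuple Z] (out_prob^~ o)
}.

Definition Pr_in (N : nat) (A : algorithm N) (x : N.-tuple Z) (S : {set O}) : R :=
  \sum_(o in S) A x o.

(* The examples of user u are the coordinates u * m, ..., u * m + m - 1. *)
Definition user_neighbors (n m : nat) (x x' : (n * m).-tuple Z) : Prop :=
  exists u : 'I_n, forall j : 'I_(n * m), (j %/ m)%N != u -> tnth x j = tnth x' j.

Definition user_level_DP (n m : nat) (eps delta : R) (A : algorithm (n * m)) : Prop :=
  forall x x' : (n * m).-tuple Z, user_neighbors x x' ->
  forall S : {set O}, Pr_in A x S <= expR eps * Pr_in A x' S + delta.

Definition useful (N : nat) (T : task) (gamma : R) (A : algorithm N) : Prop :=
  forall D : probability Z R, valid T D ->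
  (gamma%:E <= \int[iid D N]_x (Pr_in A x (correct T D))%:E)%E.

Definition achievable (T : task) (m : nat) (eps delta gamma : R) (n : nat) : Prop :=
  exists A : algorithm (n * m), user_level_DP eps delta A /\ useful T gamma A.

(* The smallest achievable number of users, +oo if there is none. *)
Definition num_users (T : task) (m : nat) (eps delta gamma : R) : \bar R :=
  ereal_inf [set n%:R%:E | n in achievable T m eps delta gamma].

Lemma num_users_min (T : task) (m : nat) (eps delta gamma : R) (n : nat) :
  achievable T m eps delta gamma n ->
  (forall k, achievable T m eps delta gamma k -> (n <= k)%N) ->
  num_users T m eps delta gamma = n%:R%:E.
Proof.
move=> an nmin; apply/eqP; rewrite eq_le; apply/andP; split.
  by apply: ereal_inf_lbound; exists n.
by apply: le_ereal_inf_tmp => _ [k ak <-]; rewrite lee_fin ler_nat; exact: nmin.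
Qed.

End tasks_and_algorithms.

Section bounds.
Context (R : realType).

(* The expression inside the soft-O; n1 is the item-level sample complexity. *)
Definition users_bound (m : nat) (eps delta : R) (n1 : \bar R) : \bar R :=
  ((ln (delta^-1) / eps)%:E
   + ((Num.sqrt m%:R)^-1 * (((ln (delta^-1)) `^ (3 / 2)) / eps))%:E * n1)%E.

(* C * f * log(f)^k, extended by +oo at +oo. *)
Definition soft_O (C : R) (k : nat) (f : \bar R) : \bar R :=
  er_map (fun r => C * r * ln r ^+ k) f.

End bounds.

(* Main.v *)
Require Import Defs.
From HB Require Import structures.
From mathcomp Require Import all_boot all_order all_algebra.
From mathcomp Require Import all_classical all_reals all_analysis.
From mathcomp Require Import measurable_realfun.
From mathcomp Require Import ring lra zify.

(* Let [A] be the item-level algorithm, on [n1] examples. Split part of the user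
   data into [n1] blocks of size [b], and let [B] run [A] on one random example of
   each block: amplification by subsampling makes [B] about [eps / b]-private per
   example. For a set [V] of at most [K ~ log(1/delta)/eps] users, let [B_V] be
   [B] with the used examples of [V] exchanged for unused examples of other users.

   On i.i.d. data, [B] and [B_V] are close with high probability. Conditionally on
   the unordered pairs of exchanged examples, the data is a uniform point of a cube
   of dimension [s <= K m], and [B_V] is [B] at the opposite point. Revealing the
   bits one by one gives a martingale with clamped steps, so that [B] is close to
   its mean on half of the cube, with [eps]-loss of order [sqrt s] instead of [s].
   Almost every point of the cube is within distance [sqrt (s log n^K)] of this
   half, and group privacy over that distance gives the high probability which
   the union bound over all [V] needs.

   The final algorithm is propose-test-release: find a smallest set [S] of users
   such that all [B_V] with [V] containing [S] agree, and release [B_S] with a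
   probability that falls from 1 at [#|S| = 0] to 0 at [#|S| = k]. Replacing the
   data of one user changes [#|S|] by at most one, and two sets [S], [S'] chosen
   for neighboring inputs are compared through [V] = [S], [S'] and that user. *)

Set Implicit Arguments.
Unset Strict Implicit.
Unset Printing Implicit Defensive.

Import Order.TTheory GRing.Theory Num.Theory.
Import numFieldNormedType.Exports.
Local Open Scope ring_scope.

(** * Indistinguishability and averages over the cube *)

Section indistinguishability.
Context (R : realFieldType) (O : finType).
Implicit Types P Q : O -> R.

(** The factor [e] is the exponential of the privacy parameter, so composition multiplies factors. A
    Boolean relation can be averaged and integrated as a 0/1 indicator. *)
Definition indist (e d : R) P Q : bool :=
  [forall S : {set O}, \sum_(o in S) P o <= e * (\sum_(o in S) Q o) + d].

Lemma indistP e d P Q :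
  reflect (forall S : {set O}, \sum_(o in S) P o <= e * (\sum_(o in S) Q o) + d)
    (indist e d P Q).
Proof. exact: forallP. Qed.

Lemma eq_indist e d P P' Q Q' : P =1 P' -> Q =1 Q' ->
  indist e d P Q = indist e d P' Q'.
Proof.
move=> PP' QQ'; rewrite /indist; apply: eq_forallb => S.
by rewrite (eq_bigr P' (fun o _ => PP' o)) (eq_bigr Q' (fun o _ => QQ' o)).
Qed.

(** The worst event is the set where [P] exceeds [e * Q], so one sum of positive parts, the
    hockey-stick divergence, replaces the quantifier over events. *)
Lemma indist_excess e d P Q :
  indist e d P Q = (\sum_o Num.max 0 (P o - e * Q o) <= d).
Proof.
have sub S : \sum_(o in S) (P o - e * Q o) =
    \sum_(o in S) P o - e * (\sum_(o in S) Q o).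
  by rewrite sumrB mulr_sumr.
apply/indistP/idP => [H|H S].
  have := H [set o | 0 < P o - e * Q o].
  rewrite addrC -lerBlDr -sub; apply: le_trans.
  rewrite [leRHS]big_mkcond /=; apply: ler_sum => o _.
  by rewrite inE; case: ltP.
rewrite addrC -lerBlDr -sub; apply: le_trans H.
rewrite big_mkcond /=; apply: ler_sum => o _.
by case: ifP => _; rewrite le_max lexx ?orbT.
Qed.

Lemma indist_refl e d P : 1 <= e -> 0 <= d -> (forall o, 0 <= P o) ->
  indist e d P P.
Proof.
move=> e1 d0 P0; apply/indistP => S.
have S0 : 0 <= \sum_(o in S) P o by exact: sumr_ge0.
by nra.
Qed.

Lemma indist_trans e1 d1 e2 d2 P Q P' : 0 <= e1 ->
  indist e1 d1 P Q -> indist e2 d2 Q P' ->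
  indist (e1 * e2) (e1 * d2 + d1) P P'.
Proof.
move=> e0 /indistP H1 /indistP H2; apply/indistP => S.
by have := H1 S; have := ler_wpM2l e0 (H2 S); lra.
Qed.

Lemma indist_weaken e d e' d' P Q : (forall o, 0 <= Q o) ->
  e <= e' -> d <= d' -> indist e d P Q -> indist e' d' P Q.
Proof.
move=> Q0 ee' dd' /indistP H; apply/indistP => S.
apply: le_trans (H S) _; apply: lerD => //; apply: ler_wpM2r => //.
exact: sumr_ge0.
Qed.

Lemma indist_mean e d P Q P' Q' : indist e d P Q -> indist e d P' Q' ->
  indist e d (fun o => (P o + P' o) / 2) (fun o => (Q o + Q' o) / 2).
Proof.
move=> /indistP H /indistP H'; apply/indistP => S.
by rewrite -!mulr_suml !big_split /=; have := H S; have := H' S; lra.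
Qed.

End indistinguishability.

Section cube.
Context (R : realFieldType).

Fixpoint cavg (s : nat) (f : seq bool -> R) : R :=
  if s is s'.+1 then cavg s' (fun t => (f (true :: t) + f (false :: t)) / 2)
  else f [::].

Implicit Types (f g : seq bool -> R) (G : seq bool -> bool).

Lemma le_cavg s f g : (forall t, size t = s -> f t <= g t) ->
  cavg s f <= cavg s g.
Proof.
elim: s f g => [|s IH] f g fg /=; first exact: fg.
apply: IH => t ts; have := fg (true :: t); have := fg (false :: t).
by rewrite /= ts => /(_ erefl) h1 /(_ erefl) h2; lra.
Qed.

Lemma eq_cavg s f g : (forall t, size t = s -> f t = g t) ->
  cavg s f = cavg s g.
Proof.
by move=> fg; apply/le_anti/andP; split; apply: le_cavg => t /fg ->.
Qed.

Lemma cavgD s f g : cavg s (fun t => f t + g t) = cavg s f + cavg s g.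
Proof.
elim: s f g => [//|s IH] f g /=; rewrite -IH; apply: eq_cavg => t _; lra.
Qed.

Lemma cavgZ s c f : cavg s (fun t => c * f t) = c * cavg s f.
Proof.
elim: s f => [//|s IH] f /=; rewrite -IH; apply: eq_cavg => t _; lra.
Qed.

Lemma cavg_cst s c : cavg s (fun=> c) = c.
Proof.
elim: s => [//|s IH] /=; rewrite -[RHS]IH; apply: eq_cavg => t _; lra.
Qed.

Lemma cavg_sum (I : finType) s (f : I -> seq bool -> R) :
  cavg s (fun t => \sum_i f i t) = \sum_i cavg s (f i).
Proof.
elim: s f => [//|s IH] f /=; rewrite -IH; apply: eq_cavg => t _.
by rewrite -mulr_suml big_split.
Qed.

Lemma cavg_ge0 s f : (forall t, size t = s -> 0 <= f t) -> 0 <= cavg s f.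
Proof. by move=> f0; rewrite -(cavg_cst s 0); exact: le_cavg. Qed.

Lemma cavgS s f : cavg s.+1 f =
  (cavg s (fun t => f (true :: t)) + cavg s (fun t => f (false :: t))) / 2.
Proof.
by rewrite /= mulrC -cavgD -cavgZ; apply: eq_cavg => t _; rewrite mulrC.
Qed.

Lemma cavg_negb s f : cavg s (fun t => f (map negb t)) = cavg s f.
Proof.
elim: s f => [//|s IH] f; rewrite [RHS]cavgS cavgS /=.
by rewrite (IH (fun t => f (false :: t))) (IH (fun t => f (true :: t))) addrC.
Qed.

Inductive adj : seq bool -> seq bool -> Prop :=
| adj_head b t : adj (b :: t) (~~ b :: t)
| adj_tail b t t' : adj t t' -> adj (b :: t) (b :: t').

Lemma adj_size t t' : adj t t' -> size t = size t'.
Proof. by elim=> //= b {}t {}t' _ ->. Qed.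

Lemma cavg_markov s f (c : R) : 0 < c -> (forall t, size t = s -> 0 <= f t) ->
  cavg s (fun t => (c <= f t)%R%:R) <= cavg s f / c.
Proof.
move=> c0 f0; rewrite mulrC -cavgZ; apply: le_cavg => t ts.
case: (leP c (f t)) => [cf|_] /=; last by rewrite mulr_ge0 ?invr_ge0 ?f0 // ltW.
by rewrite mulrC ler_pdivlMr // mul1r.
Qed.

Lemma ler_add_inv (z A : R) : 0 < z -> z <= A -> A^-1 <= z ->
  z + z^-1 <= A + A^-1.
Proof.
move=> z0 zA Az; have A0 : 0 < A by lra.
rewrite -subr_ge0 (_ : _ - _ = (A - z) * (1 - (z * A)^-1)).
  rewrite mulr_ge0 ?subr_ge0 // invf_le1 ?mulr_gt0 //.
  by rewrite -ler_pdivrMr // mul1r.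
by field; rewrite !gt_eqF.
Qed.

(** By induction on [s]. The means [U1], [U2] of [u] on the two half-cubes have a ratio [z] between
    [A^-1] and [A], and the means of the inverse are at most [L / U1] and [L / U2]. The product
    gains the factor [(2 + z + z^-1) / 4], largest at the ends of that interval. *)
Lemma cavg_lipschitz s (A : R) u : 1 <= A ->
  (forall t, 0 < u t) ->
  (forall t t', size t = s -> adj t t' -> u t <= A * u t') ->
  cavg s u * cavg s (fun t => (u t)^-1) <= ((2 + A + A^-1) / 4) ^+ s.
Proof.
move=> A1; have A0 : 0 < A by lra.
elim: s u => [|s IH] u u0 ulip.
  by rewrite /= divff ?expr0 // gt_eqF.
rewrite !cavgS exprS.
set L := _ ^+ s; set U1 := cavg s _; set U2 := cavg s _.
set V1 := cavg s _; set V2 := cavg s _.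
have lip' b t t' : size t = s -> adj t t' -> u (b :: t) <= A * u (b :: t').
  by move=> ts tt'; apply: ulip; [rewrite /= ts|exact: adj_tail].
have h1 : U1 * V1 <= L by apply: IH => //; exact: lip'.
have h2 : U2 * V2 <= L by apply: IH => //; exact: lip'.
have u12 : U1 <= A * U2.
  rewrite -cavgZ; apply: le_cavg => t ts.
  by apply: ulip; [rewrite /= ts|exact: (adj_head true)].
have u21 : U2 <= A * U1.
  rewrite -cavgZ; apply: le_cavg => t ts.
  by apply: ulip; [rewrite /= ts|exact: (adj_head false)].
have cpos (f : seq bool -> R) : (forall t, 0 < f t) -> 0 < cavg s f.
  elim: s {IH ulip L U1 U2 V1 V2 lip' h1 h2 u12 u21} f => [|s' IH'] f f0 //=.
  by apply: IH' => t; rewrite divr_gt0 ?addr_gt0.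
have U10 : 0 < U1 by apply: cpos.
have U20 : 0 < U2 by apply: cpos.
have V10 : 0 < V1 by apply: cpos => t; rewrite invr_gt0.
have V20 : 0 < V2 by apply: cpos => t; rewrite invr_gt0.
have L0 : 0 < L by apply: exprn_gt0; rewrite divr_gt0 // !addr_gt0 ?invr_gt0.
have v1 : V1 <= L / U1 by rewrite ler_pdivlMr // mulrC.
have v2 : V2 <= L / U2 by rewrite ler_pdivlMr // mulrC.
set z := U1 / U2.
have z0 : 0 < z by rewrite divr_gt0.
have zA : z <= A by rewrite ler_pdivrMr.
have Az : A^-1 <= z by rewrite ler_pdivlMr // mulrC ler_pdivrMr // mulrC.
have zz := ler_add_inv z0 zA Az.
have : (U1 + U2) / 2 * ((V1 + V2) / 2) <= (U1 + U2) / 2 * ((L / U1 + L / U2) / 2).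
  apply: ler_wpM2l; first by rewrite divr_ge0 ?addr_ge0 ?ltW.
  by rewrite ler_pM2r ?invr_gt0 // lerD.
move/le_trans; apply.
have -> : (U1 + U2) / 2 * ((L / U1 + L / U2) / 2) = (2 + (z + z^-1)) / 4 * L.
  by rewrite /z; field; rewrite !gt_eqF.
by rewrite ler_pM2r // ler_pM2r ?invr_gt0 //; move: zz; lra.
Qed.

(** A walk of exactly [r] flips. Coordinates may be flipped repeatedly, so [r] is an upper bound on
    the Hamming distance. *)
Inductive adjn : nat -> seq bool -> seq bool -> Prop :=
| adjn0 t : adjn 0 t t
| adjnS r t t' t'' : adj t t' -> adjn r t' t'' -> adjn r.+1 t t''.

Lemma adjn_tail r b t t' : adjn r t t' -> adjn r (b :: t) (b :: t').
Proof.
elim=> [?|r' x y z xy _ IH]; first exact: adjn0.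
by apply: adjnS IH; exact: adj_tail.
Qed.

Lemma adjn_size r t t' : adjn r t t' -> size t = size t'.
Proof. by elim=> // r' x y z /adj_size -> _ ->. Qed.

(* [A ^ - d], where [d] is the Hamming distance to the set [G]. *)
Fixpoint proximity (A : R) (G : seq bool -> bool) (t : seq bool) : R :=
  if t is b :: t' then
    Num.max (proximity A (fun x => G (b :: x)) t')
            (A^-1 * proximity A (fun x => G (~~ b :: x)) t')
  else (G [::])%:R.

Lemma proximity_attained A G t : 0 < A -> 0 < proximity A G t ->
  exists r t', [/\ adjn r t t', G t' & proximity A G t = A ^- r].
Proof.
move=> A0; elim: t G => [|b t IH] G /=.
  case E : (G [::]) => /= h; last by move: h; rewrite ltxx.
  by exists 0%N, [::]; split => //; [exact: adjn0|rewrite expr0 invr1].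
set x := proximity _ _ t; set y := _ * _; case: (leP x y) => _ h.
- have [|r [t' [tt' Gt' pE]]] := IH (fun x => G (~~ b :: x)).
    by move: h; rewrite pmulr_rgt0 ?invr_gt0.
  exists r.+1, (~~ b :: t'); split => //; last by rewrite /y pE exprS invfM.
  by apply: adjnS (adjn_tail _ tt'); exact: adj_head.
- have [//|r [t' [tt' Gt' pE]]] := IH (fun x => G (b :: x)).
  by exists r, (b :: t'); split => //; exact: adjn_tail.
Qed.

Lemma proximity_ge0 A G t : 0 <= A -> 0 <= proximity A G t.
Proof.
move=> A0; elim: t G => [|b t IH] G /=; first by case: (G _).
by rewrite le_max IH.
Qed.

Lemma proximity_ge1 A G t : G t -> 1 <= proximity A G t.
Proof.
elim: t G => [|b t IH] G /= Gt; first by rewrite Gt.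
by rewrite le_max (IH (fun x => G (b :: x))).
Qed.

Lemma proximity_gt0 A G t t' : 0 < A -> size t = size t' -> G t' ->
  0 < proximity A G t.
Proof.
move=> A0; elim: t t' G => [|b t IH] [|b' t'] G //=; first by move=> _ ->.
move=> [ts] Gt; rewrite lt_max; case: (eqVneq b b') => [<-|bb'] in Gt *.
  by rewrite (IH t' (fun x => G (b :: x))).
rewrite pmulr_rgt0 ?invr_gt0 // (IH t' (fun x => G (~~ b :: x))) ?orbT //.
by move: Gt; rewrite (_ : ~~ b = b') //; case: b b' bb' => [] [].
Qed.

Lemma proximity_lipschitz A G t t' : 1 <= A -> adj t t' ->
  proximity A G t <= A * proximity A G t'.
Proof.
move=> A1 tt'; have A0 : 0 < A by lra.
elim: tt' G => [b {}t|b {}t {}t' _ IH] G /=; rewrite (maxr_pMr _ _ (ltW A0)).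
- rewrite negbK ge_max !le_max mulVKf ?gt_eqF //.
  set x := proximity _ _ t; set y := proximity _ _ t.
  have x0 : 0 <= x by apply: proximity_ge0; lra.
  have y0 : 0 <= y by apply: proximity_ge0; lra.
  rewrite lexx orbT /=.
  rewrite (_ : A^-1 * y <= A * y) //.
  apply: ler_wpM2r => //; apply: (le_trans _ A1).
  by rewrite invf_le1.
- by rewrite ge_max !le_max IH /= mulrCA ler_pM2l ?invr_gt0 // IH orbT.
Qed.

(** [cavg_lipschitz] is applied to [A ^ - dist], with [dist] the Hamming distance to [G]. Its mean
    is at least 1/2 because of [G] itself, so the mean of [A ^ dist] is at most twice the bound
    there, and Markov's inequality controls the set [N] of points at distance [r] or more. *)
Lemma cavg_blowup s (A : R) G r : 1 < A ->
  1 / 2 <= cavg s (fun t => (G t)%:R) ->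
  exists N : seq bool -> bool,
    (forall t, size t = s -> ~~ N t -> exists r' t',
       [/\ (r' <= r)%N, adjn r' t t', size t' = s & G t']) /\
    cavg s (fun t => (N t)%:R) <= 2 * ((2 + A + A^-1) / 4) ^+ s / A ^+ r.
Proof.
move=> A1 G2; have A0 : 0 < A by lra.
have [g [gs Gg]] : exists g : seq bool, size g = s /\ G g.
  have : 0 < cavg s (fun t => (G t)%:R) by lra.
  elim: s G {G2} => [|s IH] G.
    by rewrite /=; case E : (G _); [exists [::]|rewrite ltxx].
  rewrite cavgS => h.
  have [h1|h1] := ltP 0 (cavg s (fun t => (G (true :: t))%:R)).
    by have [g [<- ?]] := IH (fun t => G (true :: t)) h1; exists (true :: g).
  have [|g [<- ?]] := IH (fun t => G (false :: t)); first by lra.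
  by exists (false :: g).
(* [cavg_lipschitz] asks for positivity on all lists, hence the value 1 at other lengths. *)
pose v t := if size t == s then proximity A G t else 1.
have v0 t : 0 < v t.
  rewrite /v; case: eqP => [ts|_]; last exact: ltr01.
  by apply: (proximity_gt0 _ _ Gg) => //; rewrite ts gs.
have vlip t t' : size t = s -> adj t t' -> v t <= A * v t'.
  move=> ts tt'; rewrite /v -(adj_size tt') ts eqxx.
  by apply: proximity_lipschitz => //; lra.
have := @cavg_lipschitz s A v (ltW A1) v0 vlip.
set L := _ ^+ s; set U := cavg s (fun t => (v t)^-1) => h.
have v2 : 1 / 2 <= cavg s v.
  apply: le_trans G2 _; apply: le_cavg => t ts; rewrite /v ts eqxx.
  by case E : (G t) => /=; [exact: proximity_ge1|apply: proximity_ge0; lra].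
have U0 : 0 <= U by apply: cavg_ge0 => t _; rewrite invr_ge0 ltW.
have UL : U <= 2 * L by nra.
exists (fun t => A ^+ r <= (v t)^-1); split; last first.
  apply: le_trans (@cavg_markov s (fun t => (v t)^-1) (A ^+ r) _ _) _.
  - by rewrite exprn_gt0.
  - by move=> t _; rewrite invr_ge0 ltW.
  - by rewrite ler_pM2r // invr_gt0 exprn_gt0.
move=> t ts; rewrite -ltNge => vr.
have [|r' [t' [tt' Gt' pE]]] := @proximity_attained A G t A0.
  by have := v0 t; rewrite /v ts eqxx.
exists r', t'; split => //; last by rewrite -(adjn_size tt').
move: vr; rewrite /v ts eqxx pE invrK ltr_eXn2l //; exact: ltnW.
Qed.

End cube.

(** * Likelihood ratios along the cube as a clamped martingale *)

Section clamped_martingale.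
Context (R : realFieldType) (O : finType).

Definition clamp (c h : R) := Num.max (- c) (Num.min c h).

Lemma clamp_bound c h : 0 <= c -> `|clamp c h| <= c.
Proof.
move=> c0; rewrite /clamp ler_norml le_max lexx /= ge_max ge_min lexx /=.
by rewrite andbT; lra.
Qed.

(* The deviation [h] of the first of two masses [a], [b] from their mean exceeds
   the clamp [c] only by the part of the mass that violates the ratio [e]. *)
Lemma clamp_excess (e c a b m h : R) : 0 <= a -> 0 <= b -> 1 <= e ->
  (e - 1) / 2 <= c -> m = (a + b) / 2 -> h = a / m - 1 ->
  m * `|h - clamp c h| <=
    (Num.max 0 (a - e * b) + Num.max 0 (b - e * a)) / 2.
Proof.
move=> a0 b0 e1 ec mE hE.
have M1 : 0 <= Num.max 0 (a - e * b) by rewrite le_max lexx.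
have M2 : 0 <= Num.max 0 (b - e * a) by rewrite le_max lexx.
have M3 : a - e * b <= Num.max 0 (a - e * b) by rewrite le_max lexx orbT.
have M4 : b - e * a <= Num.max 0 (b - e * a) by rewrite le_max lexx orbT.
have m0 : 0 <= m by rewrite mE; lra.
have [mz|mn] := eqVneq m 0; first by rewrite mz mul0r; lra.
have mh : m * h = (a - b) / 2.
  by rewrite hE mulrBr mulrCA divff // !mulr1 mE; lra.
have mab : 2 * m = a + b by rewrite mE; lra.
have c0 : 0 <= c by lra.
rewrite /clamp; case: (leP c h) => ch.
- rewrite max_r ?ger0_norm; [|by lra..].
  suff : 2 * (m * (h - c)) <= a - e * b by lra.
  have mc : m * c <= m * h by apply: ler_wpM2l.
  have ab : b <= a by nra.
  rewrite mulrBr mulrBr mh mulrA mab; nra.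
- case: (leP (- c) h) => ch'; first by rewrite subrr normr0 mulr0; lra.
  rewrite ltr0_norm; last by lra.
  suff : 2 * (m * - (h - - c)) <= b - e * a by lra.
  have mc : m * h <= m * (- c) by apply: ler_wpM2l => //; exact: ltW.
  have ab : a <= b by nra.
  rewrite mulrN mulrBr mh mulrN; nra.
Qed.

Variables (e d c L : R) (p : nat).
Hypotheses (e1 : 1 <= e) (ec : (e - 1) / 2 <= c) (c1 : c < 1).
Hypothesis (Lp : forall h : R, `|h| <= c ->
  ((1 + h) ^+ p + (1 - h) ^+ p) / 2 <= L).
Hypothesis (Lm : forall h : R, `|h| <= c ->
  ((1 + h) ^- p + (1 - h) ^- p) / 2 <= L).

(* Revealing the bits one at a time, each density ratio is [1 + h] or [1 - h];
   clamping [h] keeps a martingale with bounded steps, and costs at most the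
   privacy parameter [d] per step in total variation. *)
Lemma exists_weights s (F : seq bool -> O -> R) : 0 <= d ->
  (forall t o, 0 <= F t o) ->
  (forall t t', size t = s -> adj t t' -> indist e d (F t) (F t')) ->
  let Q o := cavg s (F^~ o) in
  exists w : seq bool -> O -> R,
  [/\ forall t o, 0 < w t o,
      cavg s (fun t => \sum_o `|F t o - Q o * w t o|) <= s%:R * d,
      forall o, cavg s (fun t => w t o ^+ p) <= L ^+ s &
      forall o, cavg s (fun t => w t o ^- p) <= L ^+ s].
Proof.
move=> d0; have c0 : 0 <= c by move: e1 ec; lra.
elim: s F => [|s IH] F F0 Fdp Q.
  exists (fun _ _ => 1); split => //=.
  - by rewrite big1 ?mul0r // => o _; rewrite /Q /= mulr1 subrr normr0.
  - by move=> o; rewrite expr1n expr0.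
  - by move=> o; rewrite expr1n invr1 expr0.
(* The head bit is averaged out, so it is the last one to be revealed. *)
pose F' t o : R := (F (true :: t) o + F (false :: t) o) / 2.
have F'0 t o : 0 <= F' t o by rewrite divr_ge0 ?addr_ge0.
have [|w' [w'0 wdev wp wm]] := IH F' F'0.
  move=> t t' ts tt'; apply: indist_mean.
    by apply: Fdp; [rewrite /= ts|exact: adj_tail].
  by apply: Fdp; [rewrite /= ts|exact: adj_tail].
pose h t o := F (true :: t) o / F' t o - 1.
pose hc t o := clamp c (h t o).
have hcb t o : `|hc t o| <= c by exact: clamp_bound.
have hc1 t o : 0 < 1 + hc t o by have := hcb t o; rewrite ler_norml; move: c1; lra.
have hc2 t o : 0 < 1 - hc t o by have := hcb t o; rewrite ler_norml; move: c1; lra.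
exists (fun x o => if x is b :: t then
  w' t o * (if b then 1 + hc t o else 1 - hc t o) else 1).
have L0 : 0 <= L.
  apply: le_trans (Lp (h := 0) _); last by rewrite normr0.
  by rewrite addr0 subr0 expr1n; lra.
have LS (x : R) : x <= L ^+ s -> L * x <= L ^+ s.+1.
  by move=> ?; rewrite exprS ler_wpM2l.
split.
- by move=> [|[] t] o //; rewrite mulr_gt0.
- rewrite -natr1 mulrDl mul1r /=; apply: le_trans (lerD wdev (lexx d)).
  rewrite -(cavg_cst s d) -cavgD; apply: le_cavg => t ts.
  rewrite -big_split /=.
  have dp1 : indist e d (F (true :: t)) (F (false :: t)).
    by apply: Fdp; [rewrite /= ts|exact: (adj_head true)].
  have dp2 : indist e d (F (false :: t)) (F (true :: t)).
    by apply: Fdp; [rewrite /= ts|exact: (adj_head false)].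
  move: dp1 dp2; rewrite !indist_excess => dp1 dp2.
  pose E1 o := Num.max 0 (F (true :: t) o - e * F (false :: t) o).
  pose E2 o := Num.max 0 (F (false :: t) o - e * F (true :: t) o).
  apply: (@le_trans _ _ (\sum_o (`|F' t o - Q o * w' t o| + (E1 o + E2 o) / 2))).
    rewrite mulr_suml; apply: ler_sum => o _.
    have := clamp_excess (F0 (true :: t) o) (F0 (false :: t) o) e1 ec erefl erefl.
    rewrite /= -/(F' t o) -/(h t o) -/(hc t o) -/(E1 o) -/(E2 o) => ex.
    have [Ft Ff] : F (true :: t) o = F' t o * (1 + h t o) /\
        F (false :: t) o = F' t o * (1 - h t o).
      have [F'z|F'n] := eqVneq (F' t o) 0.
        have := F0 (true :: t) o; have := F0 (false :: t) o.
        by rewrite F'z !mul0r; move: F'z; rewrite /F' => z0 x0 y0; split; lra.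
      have Fh : F' t o * h t o = F (true :: t) o - F' t o.
        by rewrite /h mulrBr mulrCA divff // !mulr1.
      move: (h t o) Fh => H Fh; rewrite mulrDr mulrBr Fh mulr1.
      by split; [|rewrite /F']; lra.
    (* The error splits into the earlier one times [1 + hc] and the clamping excess. The other value
       of the bit gives [1 - hc], so on average the earlier error is not amplified. *)
    have n1 : `|F (true :: t) o - Q o * (w' t o * (1 + hc t o))| <=
        `|F' t o - Q o * w' t o| * (1 + hc t o) + F' t o * `|h t o - hc t o|.
      rewrite -[X in _ * X + _]gtr0_norm // -[X in _ + X * _]ger0_norm //.
      rewrite -!normrM; apply: le_trans (ler_normD _ _).
      rewrite le_eqVlt; apply/orP; left; rewrite Ft; apply/eqP; congr `|_|.
      by move: (h t o) (hc t o) (F' t o) (w' t o) (Q o) => *; ring.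
    have n2 : `|F (false :: t) o - Q o * (w' t o * (1 - hc t o))| <=
        `|F' t o - Q o * w' t o| * (1 - hc t o) + F' t o * `|h t o - hc t o|.
      rewrite -[X in _ * X + _]gtr0_norm // -[X in _ + X * _]ger0_norm //.
      rewrite -!normrM; apply: le_trans (ler_normB _ _).
      rewrite le_eqVlt; apply/orP; left; rewrite Ff; apply/eqP; congr `|_|.
      by move: (h t o) (hc t o) (F' t o) (w' t o) (Q o) => *; ring.
    by move: n1 n2; rewrite !mulrDr mulrN !mulr1; lra.
  rewrite big_split /= lerD2l -mulr_suml big_split /=.
  by rewrite /E1 /E2; lra.
- move=> o; apply: (le_trans _ (LS _ (wp o))).
  rewrite -cavgZ /=; apply: le_cavg => t ts.
  rewrite !exprMn -mulrDr -mulrA mulrC.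
  apply: ler_wpM2r; last exact: Lp.
  by rewrite exprn_ge0 // ltW.
- move=> o; apply: (le_trans _ (LS _ (wm o))).
  rewrite -cavgZ /=; apply: le_cavg => t ts.
  rewrite !exprMn !invfM -mulrDr -mulrA mulrC.
  apply: ler_wpM2r; last exact: Lm.
  by rewrite invr_ge0 exprn_ge0 // ltW.
Qed.

End clamped_martingale.

(** * Closeness of opposite points of the cube *)

Section cube_concentration.
Context (R : realFieldType) (O : finType).

Lemma adj_sym t t' : adj t t' -> adj t' t.
Proof.
elim=> [b {}t|b {}t {}t' _ IH]; last exact: adj_tail.
by rewrite -[in X in adj _ X](negbK b); exact: adj_head.
Qed.

Variables (s : nat) (F : seq bool -> O -> R) (e d : R).
Hypotheses (d0 : 0 <= d) (e1 : 1 <= e).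
Hypothesis F0 : forall t o, 0 <= F t o.
Hypothesis F1 : forall t, \sum_o F t o = 1.
Hypothesis Fdp : forall t t', size t = s -> adj t t' -> indist e d (F t) (F t').

Lemma group_privacy r t t' : size t = s -> adjn r t t' ->
  indist (e ^+ r) (r%:R * e ^+ r * d) (F t) (F t') /\
  indist (e ^+ r) (r%:R * e ^+ r * d) (F t') (F t).
Proof.
move=> ts tt'; elim: tt' ts => [{}t|{}r {}t t1 {}t' tt1 _ IH] ts.
  by rewrite expr0 !mul0r; split; exact: indist_refl.
have t1s : size t1 = s by rewrite -(adj_size tt1).
have [IH1 IH2] := IH t1s.
have er : 1 <= e ^+ r by rewrite exprn_ege1.
have e0 : 0 <= e by move: e1; lra.
have rer : 0 <= r%:R * (e * e ^+ r - e ^+ r) * d.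
  rewrite !mulr_ge0 // subr_ge0 -[leLHS]mul1r ler_wpM2r //; lra.
have ed : d <= e * e ^+ r * d.
  rewrite -[leLHS]mul1r ler_wpM2r //.
  by rewrite -exprS exprn_ege1.
rewrite exprS -natr1; split.
- apply: indist_weaken (indist_trans e0 (Fdp ts tt1) IH1) => //.
  by rewrite mulrDl mulrDl mul1r; move: ed; rewrite !mulrA [e * r%:R]mulrC; lra.
- have er0 : 0 <= e ^+ r by lra.
  apply: indist_weaken (indist_trans er0 IH2 (Fdp t1s (adj_sym tt1))) => //.
    by rewrite mulrC.
  move: ed rer; have := ler_wpM2r d0 (ler_wpM2r er0 e1).
  rewrite mul1r mulrDl mulrDl mul1r mulrBr mulrBl; lra.
Qed.

Variables (c L g dg : R) (p r : nat).
Hypotheses (ec : (e - 1) / 2 <= c) (c1 : c < 1).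
Hypothesis (Lp : forall h : R, `|h| <= c ->
  ((1 + h) ^+ p.+1 + (1 - h) ^+ p.+1) / 2 <= L).
Hypothesis (Lm : forall h : R, `|h| <= c ->
  ((1 + h) ^- p.+1 + (1 - h) ^- p.+1) / 2 <= L).
Hypotheses (g1 : 1 <= g) (dg0 : 0 < dg).
Hypothesis tot : (1 + g) * (s%:R * d) + 2 * (L ^+ s / g ^+ p) <= dg / 2.

Let Q o := cavg s (F^~ o).

Let Q0 o : 0 <= Q o. Proof. exact: cavg_ge0. Qed.

Let Q1 : \sum_o Q o = 1.
Proof.
rewrite -cavg_sum -[RHS](cavg_cst s); apply: eq_cavg => t _; exact: F1.
Qed.

(** Excesses in both directions are summed, so [D t <= dg] gives closeness of [F t] and the mean [Q]
    both ways, with factor [g] and error [dg]. *)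
Let D t : R := \sum_o (Num.max 0 (F t o - g * Q o) + Num.max 0 (Q o - g * F t o)).

(** Markov's inequality in pointwise form: beyond [g], the right side [w * (w / g) ^ p] is at least
    [w]. *)
Let upper_tail (w : R) : 0 < w -> Num.max 0 (w - g) <= w ^+ p.+1 / g ^+ p.
Proof.
move=> w0; have g0 : 0 < g by move: g1; lra.
have gp0 : 0 < g ^+ p by exact: exprn_gt0.
have wp0 : 0 < w ^+ p.+1 by exact: exprn_gt0.
have q0 : 0 <= w ^+ p.+1 / g ^+ p by rewrite divr_ge0 // ltW.
rewrite ge_max q0 /=; have [wg|gw] := leP w g.
  by apply: le_trans q0; rewrite subr_le0.
rewrite ler_pdivlMr // exprS ler_pM ?subr_ge0 ?(ltW gw) ?(ltW gp0) //.
  by move: g0; lra.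
by rewrite lerXn2r ?nnegrE ?(ltW gw) ?(ltW g0) ?(ltW w0).
Qed.

Let lower_tail (w : R) : 0 < w -> Num.max 0 (1 - g * w) <= w ^- p.+1 / g ^+ p.
Proof.
move=> w0; have g0 : 0 < g by move: g1; lra.
have gp0 : 0 < g ^+ p by exact: exprn_gt0.
have wp0 : 0 < w ^- p.+1 by rewrite invr_gt0 exprn_gt0.
have q0 : 0 <= w ^- p.+1 / g ^+ p by rewrite divr_ge0 // ltW.
rewrite ge_max q0 /=; have [wg|gw] := leP 1 (g * w).
  by apply: le_trans q0; rewrite subr_le0.
have gw0 : 0 < g * w by rewrite mulr_gt0.
apply: (@le_trans _ _ 1); first by lra.
rewrite -invfM invf_ge1; last by rewrite mulr_gt0 ?exprn_gt0.
rewrite exprS -mulrA -exprMn mulrC [w * g]mulrC.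
have w1 : w <= 1 by move: g1; nra.
rewrite mulr_ile1 ?exprn_ile1 ?exprn_ge0 //; lra.
Qed.

(** Replacing [F] by [Q * w] costs [1 + g] times the total deviation. Weights outside the interval
    from [g^-1] to [g] are then paid for by the positive and negative moments of order [p.+1],
    averaged under [Q]. *)
Lemma mean_deviation : cavg s D <= dg / 2.
Proof.
have [w [w0 wdev wp wm]] := exists_weights e1 ec c1 Lp Lm d0 F0 Fdp.
rewrite -/Q in wdev.
have g0 : 0 < g by move: g1; lra.
apply: le_trans tot.
pose X t : R := \sum_o `|F t o - Q o * w t o|.
pose Y t : R := \sum_o Q o * (w t o ^+ p.+1 / g ^+ p + w t o ^- p.+1 / g ^+ p).
apply: (@le_trans _ _ (cavg s (fun t => (1 + g) * X t + Y t))).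
  apply: le_cavg => t ts; rewrite /D /X /Y mulr_sumr -big_split /=.
  apply: ler_sum => o _.
  set n := `|_|.
  have n0 : 0 <= n by exact: normr_ge0.
  have := ler_norm (F t o - Q o * w t o); rewrite -/n => n1.
  have := ler_norm (- (F t o - Q o * w t o)); rewrite normrN -/n => n2.
  have u := upper_tail (w0 t o); have l := lower_tail (w0 t o).
  have := ler_wpM2l (Q0 o) u; have := ler_wpM2l (Q0 o) l.
  rewrite !maxr_pMr // !mulr0 => l' u'; rewrite [X in _ <= _ + X]mulrDr.
  set M1 := Num.max 0 (F t o - _); set M2 := Num.max 0 (Q o - _).
  suff [m1 m2] : M1 <= n + Num.max 0 (Q o * (w t o - g)) /\
      M2 <= g * n + Num.max 0 (Q o * (1 - g * w t o)) by lra.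
  have x0 : 0 <= Num.max 0 (Q o * (w t o - g)) by rewrite le_max lexx.
  have x1 : Q o * (w t o - g) <= Num.max 0 (Q o * (w t o - g)).
    by rewrite le_max lexx orbT.
  have y0 : 0 <= Num.max 0 (Q o * (1 - g * w t o)) by rewrite le_max lexx.
  have y1 : Q o * (1 - g * w t o) <= Num.max 0 (Q o * (1 - g * w t o)).
    by rewrite le_max lexx orbT.
  have gn0 : 0 <= g * n by rewrite mulr_ge0 // ltW.
  have gn2 := ler_wpM2l (ltW g0) n2.
  rewrite !ge_max; split; apply/andP; split; lra.
rewrite cavgD cavgZ lerD //.
  by rewrite ler_wpM2l //; move: g1; lra.
have gp0 : 0 < (g ^+ p)^-1 by rewrite invr_gt0 exprn_gt0.
rewrite /Y cavg_sum -[leRHS]mul1r -[X in _ <= X * _]Q1 mulr_suml; apply: ler_sum => o _.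
rewrite cavgZ ler_wpM2l // cavgD.
have E (f : seq bool -> R) : cavg s (fun t => f t / g ^+ p) = (g ^+ p)^-1 * cavg s f.
  by rewrite -cavgZ; apply: eq_cavg => t _; rewrite mulrC.
rewrite (E (fun t => w t o ^+ p.+1)) (E (fun t => w t o ^- p.+1)).
rewrite -mulrDr [L ^+ s / _]mulrC mulrCA; apply: ler_wpM2l; first exact: ltW.
by rewrite mulr_natl mulr2n; apply: lerD; [exact: wp|exact: wm].
Qed.

Variables (A eh dh : R).
Hypotheses (A1 : 1 < A) (eh1 : e ^+ r * g <= eh).
Hypothesis dh1 : e ^+ r * dg + g * (r%:R * e ^+ r * d) <= dh.

(* A set of measure one half is within distance [r] of almost every point of the
   cube, so group privacy upgrades [mean_deviation] to high probability. *)
Lemma deviation_whp : exists N : seq bool -> bool,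
  (forall t, size t = s -> ~~ N t ->
     indist eh dh (F t) Q /\ indist eh dh Q (F t)) /\
  cavg s (fun t => (N t)%:R) <= 2 * ((2 + A + A^-1) / 4) ^+ s / A ^+ r.
Proof.
have D0 t : 0 <= D t.
  by apply: sumr_ge0 => o _; rewrite addr_ge0 // le_max lexx.
pose G t := D t <= dg.
have G2 : (1 / 2 : R) <= cavg s (fun t => (G t)%:R).
  have := @cavg_markov R s D dg dg0 (fun t _ => D0 t).
  have : cavg s D / dg <= 1 / 2.
    by rewrite ler_pdivrMr //; have := mean_deviation; lra.
  move=> h1 h2.
  pose H t : R := (dg <= D t)%R%:R.
  apply: (@le_trans _ _ (1 - cavg s H)); first by move: h1 h2; rewrite -/H; lra.
  rewrite lerBlDr -cavgD -[leLHS](cavg_cst s); apply: le_cavg => t ts.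
  by rewrite /G; rewrite /H; case: (ltgtP (D t) dg) => _ /=; lra.
have [N [NG Nm]] := cavg_blowup r A1 G2.
exists N; split => // t ts /(NG _ ts)[r' [t' [r'r tt' t's Gt']]].
have [p1 p2] := group_privacy ts tt'.
have e0 : 0 <= e by move: e1; lra.
have er1 : e ^+ r' <= e ^+ r by rewrite ler_weXn2l.
have rer : r'%:R * e ^+ r' * d <= r%:R * e ^+ r * d.
  by rewrite ler_wpM2r // ler_pM ?exprn_ge0 // ler_nat.
have er0 : 0 <= r%:R * e ^+ r * d by rewrite !mulr_ge0 // exprn_ge0.
have er'0 : 0 <= r'%:R * e ^+ r' * d by rewrite !mulr_ge0 // exprn_ge0.
have er'1 : 1 <= e ^+ r' by rewrite exprn_ege1.
have [q1 q2] : indist g dg (F t') Q /\ indist g dg Q (F t').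
  rewrite !indist_excess; split; apply: le_trans Gt'; apply: ler_sum => o _.
    by rewrite lerDl le_max lexx.
  by rewrite lerDr le_max lexx.
split.
- apply: indist_weaken (indist_trans _ p1 q1) => //; last by lra.
    apply: le_trans eh1; rewrite ler_wpM2r //; move: g1; lra.
  apply: le_trans dh1; rewrite lerD //; first by rewrite ler_wpM2r // ltW.
  by move: g1; nra.
- apply: indist_weaken (indist_trans _ q2 p2) => //; last by move: g1; lra.
    apply: le_trans eh1; rewrite mulrC ler_wpM2r //; move: g1; lra.
  apply: le_trans dh1; rewrite addrC lerD //; first by move: dg0; nra.
  by rewrite ler_wpM2l //; move: g1; lra.
Qed.

(** Negating all bits preserves the uniform mean. Off a set of twice the exceptional measure, both
    opposite points are close to [Q], hence to each other. *)
Lemma opposite_whp :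
  cavg s (fun t => (~~ (indist (eh * eh) (eh * dh + dh) (F t) (F (map negb t))
      && indist (eh * eh) (eh * dh + dh) (F (map negb t)) (F t)))%:R) <=
  4 * ((2 + A + A^-1) / 4) ^+ s / A ^+ r.
Proof.
have [N [NQ Nm]] := deviation_whp.
apply: (@le_trans _ _ (cavg s (fun t => (N t)%:R + (N (map negb t))%:R))).
  apply: le_cavg => t ts.
  have [Nt|Nt] := boolP (N t); first by case: (~~ _); case: (N _); rewrite /=; lra.
  have [Nt'|Nt'] := boolP (N _); first by case: (~~ _); rewrite /=; lra.
  have eh0 : 0 <= eh.
    apply: le_trans eh1; rewrite mulr_ge0 ?exprn_ge0 //; first by move: e1; lra.
    by move: g1; lra.
  have [a1 a2] := NQ _ ts Nt.
  have [|b1 b2] := NQ _ _ Nt'; first by rewrite size_map.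
  by rewrite (indist_trans eh0 a1 b2) (indist_trans eh0 b1 a2) /= addr0.
rewrite cavgD (cavg_negb s (fun t => (N t)%:R)); lra.
Qed.

End cube_concentration.

Local Open Scope classical_set_scope.
Local Open Scope ring_scope.

(** * Product measures *)

Section iid_reindexing.
Context (d : measure_display) (Z : measurableType d) (R : realType).

Definition pick_coords (N k : nat) (f : 'I_k -> 'I_N) (x : N.-tuple Z) :
  k.-tuple Z := [tuple tnth x (f i) | i < k].

Lemma measurable_pick_coords (N k : nat) (f : 'I_k -> 'I_N) :
  measurable_fun [set: N.-tuple Z] (pick_coords f).
Proof.
apply/measurable_fun_tnthP => i.
rewrite (_ : _ \o _ = (@tnth N Z)^~ (f i)); first exact: measurable_tnth.
by apply/funext => x /=; rewrite tnth_mktuple.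
Qed.

HB.instance Definition _ (N k : nat) (f : 'I_k -> 'I_N) :=
  @isMeasurableFun.Build _ _ _ _ (pick_coords f) (measurable_pick_coords f).

Definition boxes (k : nat) : set (set (k.-tuple Z)) :=
  [set B | exists A : 'I_k -> set Z, (forall i, measurable (A i)) /\
    B = [set x | forall i, A i (tnth x i)]].

Lemma boxes_generate (k : nat) : @measurable _ (k.-tuple Z) = <<s @boxes k >>.
Proof.
apply/seteqP; split; last first.
  apply: smallest_sub; first exact: sigma_algebra_measurable.
  by move=> _ [A [mA ->]]; exact: measurable_box.
apply: smallest_sub; first exact: smallest_sigma_algebra.
move=> B; rewrite -bigcup_seq => -[i _ [A mA <-]].
apply: sub_sigma_algebra.
exists (fun j => if j == i then A else setT); split.
  by move=> j; case: ifP.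
apply/seteqP; split => x /=.
  by move=> [_ Ax] j; case: eqP => [->|].
by move=> /(_ i); rewrite eqxx.
Qed.

(** Both measures agree on boxes, a generating pi-system. As [f] is injective, a box pulls back to
    one condition on each coordinate in the image of [f]; the full space elsewhere contributes
    factors 1. *)
Lemma iid_pick (D : probability Z R) (N k : nat) (f : 'I_k -> 'I_N)
    (E : set (k.-tuple Z)) : injective f -> measurable E ->
  distribution (iid D N) (pick_coords f) E = iid D k E.
Proof.
move=> finj mE.
apply: (@measure_unique _ _ _ (@boxes k) (fun=> setT)) => //.
- exact: boxes_generate.
- move=> _ _ [A [mA ->]] [B [mB ->]].
  exists (fun i => A i `&` B i); split; first by move=> i; exact: measurableI.
  apply/seteqP; split => x /=; first by move=> [a b] i; split.
  by move=> ab; split => i; have [] := ab i.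
- move=> _; exists (fun=> setT); split => //.
  by apply/seteqP; split.
- by rewrite bigcup_const //; exists 0%N.
- move=> _ [A [mA ->]]; apply: etrans (esym (iid_box D mA)).
  pose A' (j : 'I_N) := if [pick i | f i == j] is Some i then A i else setT.
  have mA' j : measurable (A' j) by rewrite /A'; case: pickP.
  have A'f i : A' (f i) = A i.
    by rewrite /A'; case: pickP => [i' /eqP/finj ->//|/(_ i)]; rewrite eqxx.
  transitivity (iid D N [set x | forall j, A' j (tnth x j)]).
    congr (iid D N _).
    apply/seteqP; split => x /= H.
      move=> j; rewrite /A'; case: pickP => // i /eqP <-.
      by have := H i; rewrite tnth_mktuple.
    by move=> i; rewrite tnth_mktuple -A'f; exact: H.
  rewrite iid_box // (bigID (fun j => j \in imset f (mem predT))) /=.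
  rewrite [X in (_ * X)%E]big1 ?mule1; last first.
    move=> j jf; rewrite /A'; case: pickP => [i /eqP fij|_].
      by rewrite -fij imset_f in jf.
    exact: probability_setT.
  rewrite big_imset /=; last by move=> ? ? _ _; exact: finj.
  by apply: eq_bigr => i _; rewrite A'f.
- by move=> _; apply: le_lt_trans (ltry 1); exact: probability_le1.
Qed.

Lemma integral_iid_pick (D : probability Z R) (N k : nat) (f : 'I_k -> 'I_N)
    (g : k.-tuple Z -> R) : injective f ->
  measurable_fun [set: k.-tuple Z] g -> (forall y, 0 <= g y) ->
  (\int[iid D N]_x (g (pick_coords f x))%:E = \int[iid D k]_y (g y)%:E)%E.
Proof.
move=> finj mg g0.
transitivity (\int[distribution (iid D N) (pick_coords f)]_y (g y)%:E)%E.
  by rewrite ge0_integral_distribution //; exact/measurable_EFinP.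
apply: eq_measure_integral => E mE _; exact: iid_pick.
Qed.

End iid_reindexing.

Section integral_cavg.
Context (d : measure_display) (X : measurableType d) (R : realType).

Lemma measurable_cavg s (g : seq bool -> X -> R) :
  (forall t, measurable_fun [set: X] (g t)) ->
  measurable_fun [set: X] (fun x => cavg s (g^~ x)).
Proof.
elim: s g => [|s IH] g mg /=; first exact: mg.
apply: (IH (fun t x => (g (true :: t) x + g (false :: t) x) / 2)) => t.
by apply: measurable_funM => //; exact: measurable_funD.
Qed.

Lemma integral_unit_fin (P : probability X R) (g : X -> R) :
  measurable_fun [set: X] g -> (forall x, 0 <= g x <= 1) ->
  (\int[P]_x (g x)%:E)%E \is a fin_num.
Proof.
move=> mg g01; have g0 x : [set: X] x -> (0 <= (g x)%:E)%E.
  by rewrite lee_fin; have /andP[] := g01 x.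
rewrite ge0_fin_numE; last exact: integral_ge0.
apply: (@le_lt_trans _ _ (\int[P]_x cst 1%E x)%E).
  apply: ge0_le_integral => //; first exact/measurable_EFinP.
  by move=> x _; rewrite lee_fin; have /andP[] := g01 x.
by rewrite integral_cst //= probability_setT mule1 ltry.
Qed.

(** This serves symmetrization: when all [g t] are copies of one function under measure-preserving
    maps, averaging over [t] keeps the integral. *)
Lemma integral_cavg (mu : {measure set X -> \bar R}) s (g : seq bool -> X -> R)
    (I : R) :
  (forall t, measurable_fun [set: X] (g t)) ->
  (forall t x, 0 <= g t x) ->
  (forall t, (\int[mu]_x (g t x)%:E)%E = I%:E) ->
  (\int[mu]_x (cavg s (g^~ x))%:E)%E = I%:E.
Proof.
elim: s g => [|s IH] g mg g0 gI /=; first exact: gI.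
apply: (IH (fun t x => (g (true :: t) x + g (false :: t) x) / 2)) => [t|t x|t].
- by apply: measurable_funM => //; exact: measurable_funD.
- by rewrite divr_ge0 // addr_ge0.
- under eq_integral do rewrite mulrC EFinM EFinD.
  have mE b : measurable_fun [set: X] (fun x => (g (b :: t) x)%:E).
    exact/measurable_EFinP.
  have E0 b x : [set: X] x -> (0 <= (g (b :: t) x)%:E)%E by rewrite lee_fin.
  rewrite ge0_integralZl_EFin; [|exact: measurableT| | |by rewrite invr_ge0].
  - by rewrite (ge0_integralD mu measurableT (E0 _) (mE _) (E0 _) (mE _));
      rewrite !gI -EFinD -EFinM; congr EFin; lra.
  - by move=> x Xx; rewrite adde_ge0 // E0.
  - exact: emeasurable_funD.
Qed.

End integral_cavg.

(** * Block sampling *)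

Section measurable_bool.
Context (d : measure_display) (X : measurableType d) (R : realType).

Lemma measurable_forallb (I : finType) (f : I -> X -> bool) :
  (forall i, measurable_fun [set: X] (f i)) ->
  measurable_fun [set: X] (fun x => [forall i, f i x]).
Proof.
move=> mf; apply: (measurable_fun_bool true); rewrite setTI.
rewrite (_ : _ @^-1` _ = \big[setI/setT]_(i : I) (f i @^-1` [set true])).
  apply: bigsetI_measurable => i _.
  by rewrite -[X in measurable X]setTI; exact: mf.
rewrite -bigcap_seq; apply/seteqP; split => x /=.
  by move=> /forallP fx i _; exact: fx.
by move=> fx; apply/forallP => i; apply: fx; rewrite /= mem_index_enum.
Qed.

Lemma measurable_natr_bool (f : X -> bool) : measurable_fun [set: X] f ->
  measurable_fun [set: X] (fun x => (f x)%:R : R).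
Proof.
move=> mf; rewrite (_ : (fun x => _) = fun x => if f x then 1 else 0 : R).
  exact: measurable_fun_ifT.
by apply/funext => x; case: (f x).
Qed.

Lemma measurable_sum_in (O : finType) (S : {set O}) (P : X -> O -> R) :
  (forall o, measurable_fun [set: X] (P^~ o)) ->
  measurable_fun [set: X] (fun x => \sum_(o in S) P x o).
Proof.
move=> mP; rewrite (_ : (fun x => _) =
  fun x => \sum_(o : O) if o \in S then P x o else 0).
  by apply: measurable_sum => o; case: (o \in S).
by apply/funext => x; rewrite big_mkcond.
Qed.

Lemma measurable_indist (O : finType) (e c : R) (P Q : X -> O -> R) :
  (forall o, measurable_fun [set: X] (P^~ o)) ->
  (forall o, measurable_fun [set: X] (Q^~ o)) ->
  measurable_fun [set: X] (fun x => indist e c (P x) (Q x)).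
Proof.
move=> mP mQ; apply: measurable_forallb => S.
apply: measurable_fun_ler; first exact: measurable_sum_in.
apply: measurable_funD => //; apply: measurable_funM => //.
exact: measurable_sum_in.
Qed.

End measurable_bool.

Section block_sampling.
Context (Z : Type) (R : realFieldType) (O : finType) (n b : nat).
Implicit Types (A : n.-tuple Z -> O -> R) (y : 'I_n -> 'I_b -> Z).

Definition block_sample A y (o : O) : R :=
  #|{ffun 'I_n -> 'I_b}|%:R^-1 *
  \sum_(j : {ffun 'I_n -> 'I_b}) A [tuple y l (j l) | l < n] o.

Lemma block_sample_ge0 A y o : (forall t o, 0 <= A t o) ->
  0 <= block_sample A y o.
Proof. by move=> A0; rewrite mulr_ge0 ?invr_ge0 // sumr_ge0. Qed.

Lemma card_choices_gt0 : (0 < b)%N -> 0 < #|{ffun 'I_n -> 'I_b}|%:R :> R.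
Proof. by move=> b0; rewrite ltr0n card_ffun expn_gt0 !card_ord b0. Qed.

Lemma block_sample_sum1 A y : (0 < b)%N -> (forall t, \sum_o A t o = 1) ->
  \sum_o block_sample A y o = 1.
Proof.
move=> b0 A1; rewrite -mulr_sumr exchange_big /=.
rewrite (eq_bigr (fun=> 1)) ?sumr_const; last by move=> j _; rewrite A1.
by rewrite mulVf // gt_eqF // card_choices_gt0.
Qed.

Definition set_choice (l0 : 'I_n) (j : {ffun 'I_n -> 'I_b}) (c : 'I_b) :=
  [ffun l => if l == l0 then c else j l].

(** Exchanging [c] with [j l0] is an involution on pairs [(j, c)], hence resampling the choice in
    block [l0] keeps the uniform law on choices. *)
Lemma sum_set_choice l0 (h : {ffun 'I_n -> 'I_b} -> R) :
  \sum_j \sum_c h (set_choice l0 j c) = b%:R * \sum_j h j.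
Proof.
pose swap (p : {ffun 'I_n -> 'I_b} * 'I_b) := (set_choice l0 p.1 p.2, p.1 l0).
have swapK : involutive swap.
  move=> [j c]; rewrite /swap /=; congr pair; last by rewrite ffunE eqxx.
  by apply/ffunP => l; rewrite !ffunE; case: eqP => [->|].
rewrite pair_big /= (reindex_inj (inv_inj swapK)) /=.
transitivity (\sum_(p : {ffun 'I_n -> 'I_b} * 'I_b) h p.1).
  by apply: eq_bigr => -[j c] _; congr h; have [] := swapK (j, c).
rewrite -(pair_big predT predT (fun j _ => h j)) /= mulr_sumr.
by apply: eq_bigr => j _; rewrite sumr_const card_ord mulr_natl.
Qed.

(* Privacy amplification by subsampling: the changed example enters the sample
   with probability [1 / b], and when it does, [A] cannot tell it from any other
   example of the same block. *)
Lemma block_sample_indist A y y' l0 c0 (e d : R) : (0 < b)%N ->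
  1 <= e -> (forall t o, 0 <= A t o) ->
  (forall l t t', (forall l', l' != l -> tnth t l' = tnth t' l') ->
    indist e d (A t) (A t')) ->
  (forall l c, (l, c) != (l0, c0) -> y l c = y' l c) ->
  indist (1 + (e - 1) / b%:R) (d / b%:R) (block_sample A y) (block_sample A y').
Proof.
move=> b0 e1 A0 Adp yy'; apply/indistP => S.
have bR : 0 < b%:R :> R by rewrite ltr0n.
pose a (j : {ffun 'I_n -> 'I_b}) := \sum_(o in S) A [tuple y l (j l) | l < n] o.
pose a' (j : {ffun 'I_n -> 'I_b}) := \sum_(o in S) A [tuple y' l (j l) | l < n] o.
have sumE z : \sum_(o in S) block_sample A z o = #|{ffun 'I_n -> 'I_b}|%:R^-1 *
    \sum_(j : {ffun 'I_n -> 'I_b}) \sum_(o in S) A [tuple z l (j l) | l < n] o.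
  by rewrite -mulr_sumr exchange_big.
rewrite !sumE -/a -/a'.
have C0 := card_choices_gt0 b0; set C := #|_|%:R in C0 *.
have a'0 j : 0 <= a' j by exact: sumr_ge0.
have step (j : {ffun 'I_n -> 'I_b}) : \sum_c a (set_choice l0 j c) <=
    (1 + (e - 1) / b%:R) * (\sum_c a' (set_choice l0 j c)) + d.
  have eqa c : c != c0 -> a (set_choice l0 j c) = a' (set_choice l0 j c).
    move=> cc0; apply: eq_bigr => o _; congr A; apply: eq_from_tnth => l.
    rewrite !tnth_mktuple ffunE; case: eqP => [->|/eqP ll0].
      by apply: yy'; apply: contra cc0 => /eqP[->].
    by apply: yy'; apply: contra ll0 => /eqP[->].
  have near c : a (set_choice l0 j c0) <= e * a' (set_choice l0 j c) + d.
    apply: (elimT (indistP _ _ _ _)); apply: (Adp l0) => l ll0.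
    rewrite !tnth_mktuple !ffunE (negPf ll0).
    by apply: yy'; apply: contra ll0 => /eqP[->].
  rewrite (bigD1 c0) //= (eq_bigr (fun c => a' (set_choice l0 j c))) //.
  set s := \sum_c a' _; pose m := s / b%:R.
  have sE : s = a' (set_choice l0 j c0) +
      \sum_(c < b | c != c0) a' (set_choice l0 j c) by rewrite /s (bigD1 c0).
  have avg : a (set_choice l0 j c0) <= e * m + d.
    rewrite /m mulrA -lerBlDr ler_pdivlMr // mulr_sumr.
    rewrite -[b in b%:R]card_ord mulr_natr -sumr_const; apply: ler_sum => c _.
    by rewrite lerBlDr.
  have := near c0.
  rewrite (_ : (1 + (e - 1) / b%:R) * s = s + (e - 1) * m); last first.
    by rewrite /m; field; rewrite gt_eqF.
  (* The excess over the value of [a'] at [c0] is at most [(e - 1) * m + d]: by [near c0] if that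
     value is at most [m], by [avg] otherwise. As [m] is [s / b], this gives the gain [1 / b]. *)
  have [h|h] := leP (a' (set_choice l0 j c0)) m; last by lra.
  have := ler_wpM2l (_ : 0 <= e - 1) h; rewrite subr_ge0 => /(_ e1); lra.
have := @ler_sum _ _ (index_enum _) predT _ _ (fun j _ => step j).
rewrite big_split /= -mulr_sumr !sum_set_choice sumr_const -[d *+ _]mulr_natl.
rewrite -/C => tot.
have bn : b%:R != 0 :> R by rewrite gt_eqF.
have Cn : C != 0 by rewrite gt_eqF.
rewrite -(ler_pM2l (mulr_gt0 bR C0)).
have -> : b%:R * C * (C^-1 * \sum_j a j) = b%:R * \sum_j a j by field.
apply: le_trans tot _; rewrite le_eqVlt; apply/orP; left; apply/eqP.
by field; rewrite bn Cn.
Qed.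

End block_sampling.

(** Elements of equal rank in the enumerations of [X] and [Y] are exchanged; the default value of
    [nth] fixes the surplus elements of [Y]. *)
Lemma exists_swap (T : finType) (X Y : {set T}) :
  (forall x, x \in Y -> x \notin X) -> (#|X| <= #|Y|)%N ->
  exists p : T -> T, [/\ involutive p, forall x, x \in X -> p x \in Y &
    forall x, x \notin X -> x \notin Y -> p x = x].
Proof.
move=> YX cXY.
pose p x := if x \in X then nth x (enum Y) (index x (enum X))
  else if x \in Y then nth x (enum X) (index x (enum Y)) else x.
have iX x : x \in X -> (index x (enum X) < size (enum Y))%N.
  move=> xX; rewrite -cardE; apply: leq_trans cXY.
  by rewrite cardE index_mem mem_enum.
have pX x : x \in X -> p x \in Y.
  by move=> xX; rewrite /p xX -mem_enum mem_nth // iX.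
exists p; split => //; last by move=> x /negPf xX /negPf xY; rewrite /p xX xY.
move=> x; rewrite {2}/p; case: ifPn => xX.
  have yY : nth x (enum Y) (index x (enum X)) \in Y.
    by rewrite -mem_enum mem_nth // iX.
  rewrite /p (negPf (YX _ yY)) yY index_uniq ?enum_uniq ?iX //.
  by rewrite (set_nth_default x) ?nth_index ?index_mem ?mem_enum.
case: ifPn => xY; last by rewrite /p (negPf xX) (negPf xY).
have [lt|ge] := ltnP (index x (enum Y)) (size (enum X)); last first.
  rewrite nth_default //; rewrite /p (negPf xX) xY nth_default //.
have yX : nth x (enum X) (index x (enum Y)) \in X.
  by rewrite -mem_enum mem_nth.
rewrite /p yX index_uniq ?enum_uniq //.
by rewrite (set_nth_default x) ?nth_index ?index_mem ?mem_enum // mem_enum.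
Qed.

Lemma adj_differ (t t' : seq bool) : adj t t' -> exists2 q, (q < size t)%N &
  forall q', q' != q -> nth false t q' = nth false t' q'.
Proof.
elim=> [b {}t|b {}t {}t' _ [q qs tt']]; first by exists 0%N => // -[].
by exists q.+1 => // -[//|q'] qq'; exact: tt'.
Qed.

Section block_algorithm.
Context (d : measure_display) (Z : measurableType d) (R : realType) (O : finType).
Context (n b N : nat) (b0 : (0 < b)%N) (A : algorithm Z O R n).
Implicit Types it : 'I_n -> 'I_b -> 'I_N.

Definition block_prob it (x : N.-tuple Z) (o : O) : R :=
  block_sample A (fun l c => tnth x (it l c)) o.

Lemma measurable_block_prob it o :
  measurable_fun [set: N.-tuple Z] (fun x => block_prob it x o).
Proof.
apply: measurable_funM => //; apply: measurable_sum => j.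
rewrite (_ : (fun x => _) =
  (out_prob A)^~ o \o pick_coords (fun l => it l (j l))) //.
apply: measurableT_comp; first exact: measurable_out_prob.
exact: measurable_pick_coords.
Qed.

Definition block_algorithm it : algorithm Z O R N :=
  @Algorithm _ Z O R N (block_prob it)
    (fun x o => block_sample_ge0 _ _ (@out_prob_ge0 _ _ _ _ _ A))
    (fun x => block_sample_sum1 _ b0 (@out_prob_sum1 _ _ _ _ _ A))
    (measurable_block_prob it).

(** Every choice reads [n] distinct coordinates of i.i.d. data, so block sampling preserves
    usefulness exactly. *)
Lemma integral_block it (D : probability Z R) (S : {set O}) :
  (forall l c l' c', it l c = it l' c' -> l = l' /\ c = c') ->
  (\int[iid D N]_x (Pr_in (block_algorithm it) x S)%:E =
   \int[iid D n]_x (Pr_in A x S)%:E)%E.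
Proof.
move=> itinj.
have mP : measurable_fun [set: n.-tuple Z] (fun x => Pr_in A x S).
  by apply: measurable_sum_in; exact: measurable_out_prob.
have P0 x : 0 <= Pr_in A x S by apply: sumr_ge0 => o _; exact: out_prob_ge0.
pose pk (j : {ffun 'I_n -> 'I_b}) := pick_coords (Z := Z) (fun l => it l (j l)).
have PE x : Pr_in (block_algorithm it) x S =
    #|{ffun 'I_n -> 'I_b}|%:R^-1 * \sum_j Pr_in A (pk j x) S.
  by rewrite /Pr_in /= /block_prob /block_sample -mulr_sumr exchange_big.
under eq_integral do rewrite PE EFinM -sumEFin.
have mpk j : measurable_fun [set: N.-tuple Z]
    (fun x => (Pr_in A (pk j x) S)%:E).
  apply/measurable_EFinP; apply: measurableT_comp mP _.
  exact: measurable_pick_coords.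
rewrite ge0_integralZl_EFin; [|exact: measurableT| | |by rewrite invr_ge0].
- rewrite (ge0_integral_sum _ measurableT mpk); last first.
    by move=> j x _; rewrite lee_fin.
  rewrite (eq_bigr (fun=> \int[iid D n]_x (Pr_in A x S)%:E)%E); last first.
    move=> j _; apply: (integral_iid_pick _ (g := fun x => Pr_in A x S)) => //.
    by move=> l l' /itinj[].
  have If : (\int[iid D n]_x (Pr_in A x S)%:E)%E \is a fin_num.
    apply: integral_unit_fin => // x; rewrite P0 /=.
    rewrite -(out_prob_sum1 A x) [leRHS](bigID (fun o => o \in S)) /= lerDl.
    by apply: sumr_ge0 => o _; exact: out_prob_ge0.
  rewrite -(fineK If) sumEFin -EFinM sumr_const.
  rewrite -[X in (_ * X)%:E]mulr_natl mulrA mulVf ?mul1r //.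
  by rewrite gt_eqF // card_choices_gt0.
- by move=> x _; apply: sume_ge0 => j _; rewrite lee_fin.
- exact: emeasurable_sum.
Qed.

Variables (e c : R) (D : probability Z R) (it : 'I_n -> 'I_b -> 'I_N).
Variables (X : {set 'I_N}) (p : 'I_N -> 'I_N).
Hypothesis e1 : 1 <= e.
Hypothesis Adp : forall l (t t' : n.-tuple Z),
  (forall l', l' != l -> tnth t l' = tnth t' l') -> indist e c (A t) (A t').
Hypothesis itinj : forall l c l' c', it l c = it l' c' -> l = l' /\ c = c'.
Hypothesis pK : involutive p.
Hypothesis Xused : forall i, i \in X -> exists l c, i = it l c.
Hypothesis pX : forall i, i \in X -> p i \notin X.
Hypothesis pit : forall l c, it l c \notin X -> p (it l c) = it l c.

(** Each bit of [t] says whether the element of [X] of that rank trades places with its partner. For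
    [t] of length [#|X|], the index of an element outside [X] is past the end and reads [false]. *)
Let flip (t : seq bool) i :=
  nth false t (index i (enum X)) || nth false t (index (p i) (enum X)).

Let theta t i := if flip t i then p i else i.

Let thetaK t : involutive (theta t).
Proof.
have flipp i : flip t (p i) = flip t i by rewrite /flip pK orbC.
move=> i; rewrite {2}/theta; case: ifPn => f; last by rewrite /theta (negPf f).
by rewrite /theta flipp f pK.
Qed.

Let flip_used t l c' : size t = #|X| ->
  flip t (it l c') = nth false t (index (it l c') (enum X)).
Proof.
move=> ts; rewrite /flip; have [iX|iX] := boolP (it l c' \in X); last first.
  by rewrite pit // orbb.
rewrite [X in _ || X](_ : _ = false) ?orbF //.
by rewrite nth_default // memNindex ?mem_enum ?pX // -cardE ts.
Qed.

Let used_index t l c' : size t = #|X| -> it l c' \notin X ->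
  nth false t (index (it l c') (enum X)) = false.
Proof.
by move=> ts iX; rewrite nth_default // memNindex ?mem_enum // -cardE ts.
Qed.

(** Reading the partner after a partial swap amounts to reading the original after the complementary
    swap. This turns the exchange of all of [X] into the passage to the opposite point. *)
Let swap_theta t l c' : size t = #|X| ->
  theta t (p (it l c')) = theta (map negb t) (it l c').
Proof.
move=> ts; rewrite /theta /flip pK [in LHS]orbC -!/(flip _ _) !flip_used //;
  last by rewrite size_map.
have [iX|iX] := boolP (it l c' \in X); last first.
  by rewrite !used_index ?size_map // pit.
rewrite (nth_map false) ?ts ?cardE ?index_mem ?mem_enum //.
by case: (nth _ _ _).
Qed.

Variables (e2 c2 beta : R).
Hypothesis conc : forall F : seq bool -> O -> R,
  (forall t o, 0 <= F t o) -> (forall t, \sum_o F t o = 1) ->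
  (forall t t', size t = #|X| -> adj t t' ->
    indist (1 + (e - 1) / b%:R) (c / b%:R) (F t) (F t')) ->
  cavg #|X| (fun t => (~~ (indist e2 c2 (F t) (F (map negb t))
    && indist e2 c2 (F (map negb t)) (F t)))%:R) <= beta.

Definition separated (x : N.-tuple Z) : bool :=
  ~~ (indist e2 c2 (block_prob it x) (block_prob (fun l c => p (it l c)) x) &&
      indist e2 c2 (block_prob (fun l c => p (it l c)) x) (block_prob it x)).

Lemma measurable_separated : measurable_fun [set: N.-tuple Z] separated.
Proof.
apply: measurable_neg; apply: measurable_and; apply: measurable_indist;
  exact: measurable_block_prob.
Qed.

(* [iid D N] is invariant under swapping any subset of the pairs [i], [p i], so
   the probability is the mean over the cube of such subsets, where [separated]
   compares opposite points. *)
Lemma separated_whp :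
  (\int[iid D N]_x ((separated x)%:R)%:E <= beta%:E)%E.
Proof.
have ms := @measurable_natr_bool _ _ R _ measurable_separated.
have If : (\int[iid D N]_x ((separated x)%:R)%:E)%E \is a fin_num.
  by apply: integral_unit_fin => // x; case: (separated x); rewrite /= lexx ler01.
have inv t : (\int[iid D N]_x ((separated (pick_coords (theta t) x))%:R)%:E)%E
    = (fine (\int[iid D N]_x ((separated x)%:R)%:E)%E)%:E.
  rewrite fineK //.
  apply: (integral_iid_pick _ (g := fun x => (separated x)%:R)) => //.
  exact: (inv_inj (thetaK t)).
rewrite -(fineK If).
rewrite -(@integral_cavg _ _ _ (iid D N) #|X|
  (fun t x => (separated (pick_coords (theta t) x))%:R) _ _ _ inv) //; last first.
  move=> t; apply: measurableT_comp ms _; exact: measurable_pick_coords.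
rewrite -[leRHS](_ : \int[iid D N]_x (cst beta%:E) x = _)%E; last first.
  by rewrite integral_cst //= probability_setT mule1.
apply: ge0_le_integral => //.
- by move=> x _; rewrite lee_fin; apply: cavg_ge0.
- apply/measurable_EFinP; apply: measurable_cavg => t.
  apply: measurableT_comp ms _; exact: measurable_pick_coords.
move=> x _; rewrite lee_fin.
pose F t := block_prob (fun l c => theta t (it l c)) x.
rewrite (eq_cavg (g := fun t => (~~ (indist e2 c2 (F t) (F (map negb t))
    && indist e2 c2 (F (map negb t)) (F t)))%:R)); last first.
  move=> t ts; congr (nat_of_bool _)%:R.
  have E1 : block_prob it (pick_coords (theta t) x) = F t.
    apply/funext => o; rewrite /F /block_prob; congr block_sample.
    by apply/funext => l; apply/funext => c'; rewrite tnth_mktuple.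
  have E2 : block_prob (fun l c => p (it l c)) (pick_coords (theta t) x) =
      F (map negb t).
    apply/funext => o; rewrite /F /block_prob; congr block_sample.
    apply/funext => l; apply/funext => c'; rewrite tnth_mktuple.
    by rewrite swap_theta.
  by rewrite /separated E1 E2.
apply: conc => [t o|t|t t' ts tt'].
- exact: (out_prob_ge0 (block_algorithm _)).
- exact: (out_prob_sum1 (block_algorithm _)).
(* At adjacent points, the blocks differ in the single slot that holds [i0], as subsampling
   amplification requires. *)
have [q qs qtt'] := adj_differ tt'.
have qX : (q < #|X|)%N by rewrite -ts.
pose i0 := @enum_val _ (mem X) (Ordinal qX).
have [l0 [c0 i0E]] : exists l c, i0 = it l c by apply: Xused; exact: enum_valP.
have t's : size t' = #|X| by rewrite -(adj_size tt').
apply: (block_sample_indist (l0 := l0) (c0 := c0)) => //.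
  exact: out_prob_ge0.
move=> l c' lc; congr (tnth x _); rewrite /theta !flip_used // qtt' //.
apply: contra lc => /eqP iq.
have : i0 = it l c'.
  rewrite /i0 (enum_val_nth (it l c')) /= -iq nth_index //.
  by rewrite -index_mem iq -cardE.
by rewrite i0E => /itinj[-> ->].
Qed.

End block_algorithm.

(** * Propose-test-release *)

(** The decision to release, costing [e2] and [d2], is composed with the released value, costing [e]
    and [d]. Values are compared only if both inputs release with positive probability; if [q'] is
    0, the mass [q] is at most [d2]. *)
Lemma mixture_bound (R : realFieldType) (e d e2 d2 q q' P P' c : R) :
  1 <= e -> 0 <= d -> 1 <= e2 -> 0 <= d2 ->
  0 <= c <= 1 -> 0 <= P <= 1 -> 0 <= P' -> 0 <= q -> 0 <= q' <= 1 ->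
  q <= e2 * q' + d2 -> 1 - q <= e2 * (1 - q') + d2 ->
  (q != 0 -> q' != 0 -> P <= e * P' + d) ->
  q * P + (1 - q) * c <=
    e2 * e * (q' * P' + (1 - q') * c) + (e2 * d + 2 * d2).
Proof.
move=> e1 d0 e21 d20 /andP[c0 c1] /andP[P0 P1] P'0 q0 /andP[q'0 q'1] p1 p2 ind.
have e0 : 0 <= e by exact: le_trans e1.
have e20 : 0 <= e2 by exact: le_trans e21.
have main : q * P <= e2 * e * (q' * P') + e2 * d + d2.
  have r0 : 0 <= e2 * e * (q' * P') by rewrite !mulr_ge0.
  have r1 : 0 <= e2 * d by rewrite mulr_ge0.
  have [qz|qn] := eqVneq q 0; first by rewrite qz mul0r !addr_ge0.
  have [q'z|q'n] := eqVneq q' 0.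
    move: p1; rewrite q'z mulr0 add0r mul0r mulr0 add0r => p1.
    by apply: le_trans (ler_piMr q0 P1) _; apply: le_trans p1 _; rewrite lerDr.
  have h1 : q * P <= e2 * q' * P + d2.
    apply: (@le_trans _ _ ((e2 * q' + d2) * P)); first by rewrite ler_wpM2r.
    by rewrite mulrDl lerD2l ler_piMr.
  apply: le_trans h1 _; rewrite lerD2r.
  have h2 := ler_wpM2l (mulr_ge0 e20 q'0) (ind qn q'n); apply: le_trans h2 _.
  rewrite mulrDr lerD //; last by rewrite -mulrA ler_wpM2l // ler_piMl.
  by rewrite le_eqVlt; apply/orP; left; apply/eqP; ring.
have q'c : 0 <= (1 - q') * c by rewrite mulr_ge0 // subr_ge0.
have rest : (1 - q) * c <= e2 * e * ((1 - q') * c) + d2.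
  apply: (@le_trans _ _ ((e2 * (1 - q') + d2) * c)); first by rewrite ler_wpM2r.
  rewrite mulrDl lerD //; last by rewrite ler_piMr.
  by rewrite -!mulrA ler_wpM2l // ler_peMl.
rewrite mulrDr; lra.
Qed.

Section propose_test_release.
Context (d : measure_display) (Z : measurableType d) (R : realType) (O : finType).
Context (n m K k : nat) (B : {set 'I_n} -> algorithm Z O R (n * m)).
Context (e1 d1 e2 d2 : R) (p : nat -> R) (C : O -> R).

Hypothesis Blocal : forall (V : {set 'I_n}) (x x' : (n * m).-tuple Z),
  (#|V| <= K)%N ->
  (forall i : 'I_(n * m), (forall u : 'I_n, u \in V -> (i %/ m)%N != u) ->
     tnth x i = tnth x' i) ->
  B V x =1 B V x'.
Hypotheses (e11 : 1 <= e1) (d10 : 0 <= d1) (e21 : 1 <= e2) (d20 : 0 <= d2).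
Hypotheses (C0 : forall o, 0 <= C o) (C1 : \sum_o C o = 1).
Hypothesis p01 : forall i, 0 <= p i <= 1.
Hypothesis p0 : p 0 = 1.
Hypothesis pk : forall i, (k <= i)%N -> p i = 0.
Hypothesis kK : (k.*2 <= K)%N.
Hypothesis pstep : forall i j, (i <= j.+1)%N -> (j <= i.+1)%N ->
  p i <= e2 * p j + d2 /\ 1 - p i <= e2 * (1 - p j) + d2.

Implicit Types (S V : {set 'I_n}) (x : (n * m).-tuple Z).

Definition stable x S : bool :=
  [forall V : {set 'I_n}, forall V' : {set 'I_n},
    [&& S \subset V, S \subset V', (#|V| <= K)%N & (#|V'| <= K)%N] ==>
    indist e1 d1 (B V x) (B V' x)].

Lemma stableP x S : reflect (forall V V', S \subset V -> S \subset V' ->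
    (#|V| <= K)%N -> (#|V'| <= K)%N -> indist e1 d1 (B V x) (B V' x))
  (stable x S).
Proof.
apply: (iffP forallP) => [H V V' SV SV' VK V'K|H V].
  by have /forallP/(_ V')/implyP := H V; apply; rewrite SV SV' VK V'K.
by apply/forallP => V'; apply/implyP => /and4P[]; exact: H.
Qed.

Lemma measurable_stable S : measurable_fun [set: (n * m).-tuple Z] (stable^~ S).
Proof.
apply: measurable_forallb => V; apply: measurable_forallb => V'.
case: [&& _, _, _ & _] => //=.
by apply: measurable_indist; exact: measurable_out_prob.
Qed.

(** The set depends on the finite table of stable sets alone, so [ptr_prob] is measurable by a case
    split over finitely many tables. *)
Definition least_in (w : {ffun {set 'I_n} -> bool}) : {set 'I_n} :=
  [arg min_(S < [set: 'I_n]%SET | w S) #|S|]%N.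

Definition deleted x := least_in [ffun S => stable x S].

Lemma stable_setT x : stable x [set: 'I_n]%SET.
Proof.
apply/stableP => V V'; rewrite !finset.subTset => /eqP -> /eqP -> _ _.
by apply: indist_refl => // o; exact: out_prob_ge0.
Qed.

Lemma deletedP x : stable x (deleted x) /\
  forall S, stable x S -> (#|deleted x| <= #|S|)%N.
Proof.
rewrite /deleted /least_in; case: arg_minnP; first by rewrite ffunE stable_setT.
by move=> S; rewrite ffunE => xS Smin; split => // S' xS'; rewrite Smin ?ffunE.
Qed.

Definition released S x (o : O) : R :=
  p #|S| * B S x o + (1 - p #|S|) * C o.

Definition ptr_prob x := released (deleted x) x.

Lemma ptr_prob_ge0 x o : 0 <= ptr_prob x o.
Proof.
rewrite /ptr_prob /released; have /andP[q0 q1] := p01 #|deleted x|.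
by rewrite addr_ge0 // mulr_ge0 ?subr_ge0 ?out_prob_ge0.
Qed.

Lemma ptr_prob_sum1 x : \sum_o ptr_prob x o = 1.
Proof.
rewrite big_split -!mulr_sumr C1 out_prob_sum1 /=; lra.
Qed.

Lemma measurable_ptr_prob o :
  measurable_fun [set: (n * m).-tuple Z] (ptr_prob^~ o).
Proof.
pose st x := [ffun S : {set 'I_n} => stable x S].
rewrite (_ : _^~ _ = fun x => \sum_(w : {ffun {set 'I_n} -> bool})
    (if [forall S, stable x S == w S] then released (least_in w) x o else 0)).
  apply: measurable_sum => w; apply: measurable_fun_ifT => //.
    apply: measurable_forallb => S; case: (w S).
      rewrite (_ : (fun x => _) = stable^~ S); first exact: measurable_stable.
      by apply/funext => x; case: (stable x S).
    rewrite (_ : (fun x => _) = fun x => ~~ stable x S).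
      by apply: measurable_neg; exact: measurable_stable.
    by apply/funext => x; case: (stable x S).
  apply: measurable_funD => //; apply: measurable_funM => //.
  exact: measurable_out_prob.
apply/funext => x; rewrite (bigD1 (st x)) //= big1 ?addr0 => [|w wst].
  by rewrite ifT //; apply/forallP => S; rewrite ffunE.
case: ifPn => // /forallP H; case/negP: wst; apply/eqP/ffunP => S.
by rewrite ffunE -(eqP (H S)).
Qed.

Definition ptr : algorithm Z O R (n * m) :=
  Algorithm ptr_prob_ge0 ptr_prob_sum1 measurable_ptr_prob.

Lemma ptr_stable x o : stable x finset.set0 -> ptr x o = B finset.set0 x o.
Proof.
move=> x0; have [_ /(_ _ x0)] := deletedP x.
rewrite cards0 leqn0 cards_eq0 /= /ptr_prob => /eqP ->.
by rewrite /released cards0 p0 subrr mul0r addr0 mul1r.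
Qed.

Section neighbors.
Variables (x x' : (n * m).-tuple Z) (u : 'I_n).
Hypothesis xx' : forall j : 'I_(n * m), (j %/ m)%N != u -> tnth x j = tnth x' j.

Lemma neighbors_eq V : (#|V| <= K)%N -> u \in V -> B V x =1 B V x'.
Proof. by move=> VK uV; apply: Blocal => // i iV; apply: xx'; exact: iV. Qed.

(** Adding [u] to a set stable at [x] gives a set stable at [x'], because every algorithm then
    compared ignores the data of [u]. *)
Lemma card_deleted_le : (#|deleted x'| <= #|deleted x|.+1)%N.
Proof.
have [xS _] := deletedP x; have [_ min'] := deletedP x'.
apply: leq_trans (min' (u |: deleted x) _) _; last first.
  by rewrite cardsU1; case: (_ \notin _) => //; rewrite leqW.
apply/stableP => V V'; rewrite !finset.subUset !finset.sub1set.
move=> /andP[uV SV] /andP[uV' SV'].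
move=> VK V'K; rewrite -(eq_indist _ _ (neighbors_eq VK uV) (neighbors_eq V'K uV')).
exact: (stableP _ _ xS).
Qed.

Lemma deleted_indist : (#|deleted x| < k)%N -> (#|deleted x'| < k)%N ->
  indist (e1 * e1) (e1 * d1 + d1) (B (deleted x) x) (B (deleted x') x').
Proof.
move=> sk s'k; have [/stableP xS _] := deletedP x.
have [/stableP x'S _] := deletedP x'.
pose V := u |: (deleted x :|: deleted x').
have uV : u \in V by rewrite !inE eqxx.
(* Both deleted sets have fewer than [k] elements, which leaves room for [u] within [k.*2]. *)
have VK : (#|V| <= K)%N.
  apply: leq_trans kK; rewrite cardsU1 -addnn.
  apply: (@leq_trans (1 + (#|deleted x| + #|deleted x'|))).
    by apply: leq_add; [case: (_ \notin _)|rewrite cardsU leq_subr].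
  by rewrite addnA add1n leq_add // ltnW.
have kK' : (k <= K)%N by apply: leq_trans kK; rewrite -addnn leq_addr.
apply: (@indist_trans _ _ _ _ _ _ _ (B V x)); first by move: e11; lra.
  apply: xS => //; last by rewrite (leq_trans (ltnW sk)).
  exact: fintype.subset_trans (finset.subsetUl _ _) (finset.subsetUr _ _).
rewrite (eq_indist _ _ (neighbors_eq VK uV) (frefl _)).
apply: x'S => //; last by rewrite (leq_trans (ltnW s'k)).
exact: fintype.subset_trans (finset.subsetUr _ _) (finset.subsetUr _ _).
Qed.

End neighbors.

Lemma ptr_DP eps delta : e2 * (e1 * e1) <= expR eps ->
  e2 * (e1 * d1 + d1) + 2 * d2 <= delta -> user_level_DP eps delta ptr.
Proof.
move=> He Hd x x' [u xx'] S.
have s1 := card_deleted_le xx'.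
have x'x (j : 'I_(n * m)) : (j %/ m)%N != u -> tnth x' j = tnth x j.
  by move=> ju; rewrite xx'.
have s2 := card_deleted_le x'x.
have [p1 p2] := pstep s2 s1.
have prE y : Pr_in ptr y S = p #|deleted y| * Pr_in (B (deleted y)) y S +
    (1 - p #|deleted y|) * \sum_(o in S) C o.
  by rewrite /Pr_in big_split -!mulr_sumr.
rewrite !prE.
have PrS (A : algorithm Z O R (n * m)) y : 0 <= Pr_in A y S <= 1.
  rewrite sumr_ge0 => [|o _]; last exact: out_prob_ge0.
  rewrite -(out_prob_sum1 A y) [leRHS](bigID (fun o => o \in S)) /= lerDl.
  by apply: sumr_ge0 => o _; exact: out_prob_ge0.
have c0 : 0 <= \sum_(o in S) C o by exact: sumr_ge0.
have c1 : \sum_(o in S) C o <= 1.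
  rewrite -C1 [leRHS](bigID (fun o => o \in S)) /= lerDl.
  exact: sumr_ge0.
have /andP[P'0 _] := PrS (B (deleted x')) x'.
have /andP[q0 _] := p01 #|deleted x|.
have e10 : 0 <= e1 by exact: le_trans e11.
have /andP[t0 _] := PrS ptr x'; rewrite prE in t0.
apply: le_trans (lerD (ler_wpM2r t0 He) Hd).
apply: mixture_bound => //.
- exact: mulr_ege1.
- by rewrite addr_ge0 // mulr_ge0.
- by rewrite c0.
- move=> pn p'n; apply: (elimT (indistP _ _ _ _)).
  by apply: (deleted_indist xx'); rewrite ltnNge;
    [apply: contra pn|apply: contra p'n] => /pk ->.
Qed.

End propose_test_release.

(** * Replacing the examples of a set of users *)

(** A set of at most [K] users is encoded by its enumeration, padded with [None] to a map from
    ['I_K] to [option 'I_n]. *)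
Lemma card_small_sets (n K : nat) :
  (#|[set V : {set 'I_n} | (#|V| <= K)%N]%SET| <= n.+1 ^ K)%N.
Proof.
pose img (f : {ffun 'I_K -> option 'I_n}) := [set u | Some u \in codom f]%SET.
have cE : #|{ffun 'I_K -> option 'I_n}| = (n.+1 ^ K)%N.
  by rewrite card_ffun card_option !card_ord.
rewrite -cE -cardsT; apply: leq_trans (leq_imset_card img _).
apply: subset_leq_card; apply/fintype.subsetP => V; rewrite inE => VK.
apply/imsetP; exists [ffun i : 'I_K => onth (enum V) i]; rewrite ?inE //.
apply/setP => u; rewrite inE; apply/idP/codomP => [uV|[i]].
  have iV : (index u (enum V) < #|V|)%N by rewrite cardE index_mem mem_enum.
  exists (Ordinal (leq_trans iV VK)); rewrite ffunE /=.
  by rewrite onthE (nth_map u) -?cardE // nth_index // mem_enum.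
by rewrite ffunE => E; rewrite -mem_enum; apply/onthP; exists i.
Qed.

Section items.
Context (n m n1 b K : nat) (m0 : (0 < m)%N) (b0 : (0 < b)%N).
Hypothesis room : (n1 * b + K * m <= n * m)%N.

Lemma item_subproof (l : 'I_n1) (c : 'I_b) : (l * b + c < n * m)%N.
Proof.
apply: leq_trans room; apply: ltn_addr.
apply: (@leq_trans (l.+1 * b)); first by rewrite mulSn addnC ltn_add2r.
by rewrite leq_mul2r ltn_ord orbT.
Qed.

(** The blocks fill an initial segment of the data, and their boundaries need not match those of
    users. *)
Definition item l c : 'I_(n * m) := Ordinal (item_subproof l c).

Lemma item_inj l c l' c' : item l c = item l' c' -> l = l' /\ c = c'.
Proof.
move=> /(congr1 val) /= E; split; apply: val_inj => /=.
  have := congr1 (divn^~ b) E.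
  by rewrite !divnMDl // !divn_small // !addn0.
by have := congr1 (modn^~ b) E; rewrite !modnMDl !modn_small.
Qed.

Implicit Types V : {set 'I_n}.

Definition owned V : {set 'I_(n * m)} :=
  [set i : 'I_(n * m) | [exists u in V, (i %/ m)%N == u]]%SET.

Definition used : {set 'I_(n * m)} := [set item p.1 p.2 | p : 'I_n1 * 'I_b]%SET.

Lemma card_owned V : (#|owned V| <= #|V| * m)%N.
Proof.
have lt (p : 'I_n * 'I_m) : (p.1 * m + p.2 < n * m)%N.
  apply: (@leq_trans (p.1.+1 * m)); first by rewrite mulSn addnC ltn_add2r.
  by rewrite leq_mul2r ltn_ord orbT.
rewrite -[m in leqRHS]card_ord -[#|'I_m|]cardsT -cardsX.
apply: leq_trans (leq_imset_card (fun p => Ordinal (lt p)) _).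
apply: subset_leq_card; apply/fintype.subsetP => i; rewrite inE.
move=> /existsP[u /andP[uV /eqP iu]].
apply/imsetP; exists (u, Ordinal (ltn_pmod i m0)); first by rewrite !inE uV.
by apply: val_inj; rewrite /= -iu -divn_eq.
Qed.

(** The sizes of [used] and [owned V] add up to at most [n * m], so by inclusion-exclusion there are
    at least as many places outside their union as in their intersection. The bound on [#|V|] stands
    under the existential so that choice yields a map defined on all [V]. *)
Lemma exists_replacement V : exists p : 'I_(n * m) -> 'I_(n * m),
  (#|V| <= K)%N -> [/\ involutive p,
    forall i, i \in used :&: owned V -> p i \notin used :|: owned V &
    forall i, i \in used -> i \notin owned V -> p i = i].
Proof.
have [VK|VK] := leqP #|V| K; last first.
  by exists id.
have [|//|p [pK pX pfix]] := @exists_swap _ (used :&: owned V)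
    (~: (used :|: owned V)).
- by move=> i; rewrite !inE; case: (i \in used) => //; case: (i \in owned V).
- have cu : (#|used| <= n1 * b)%N.
    apply: leq_trans (leq_imset_card _ _) _.
    by rewrite card_prod !card_ord.
  have co := card_owned V.
  have := cardsUI used (owned V).
  have := cardsC (used :|: owned V); rewrite card_ord.
  have : (#|V| * m <= K * m)%N by rewrite leq_mul2r VK orbT.
  move: room cu co.
  set a := #|_ :&: _|; set u := #|_ :|: _|; set c := #|~: _|.
  set x := #|used|; set y := #|owned V|.
  move=> h1 h2 h3 h4 h5 h6; lia.
exists p => _; split => // i; first by move=> /pX; rewrite finset.in_setC.
move=> iu iV; apply: pfix; first by rewrite finset.in_setI (negPf iV) andbF.
by rewrite finset.in_setC finset.in_setU iu.
Qed.

End items.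

(** * From an item-level to a user-level algorithm *)

Section transfer.
Context (d : measure_display) (Z : measurableType d) (R : realType) (O : finType).
Context (T : task Z O R) (gamma eps delta delta' : R).
Context (n m n1 b K k : nat) (A : algorithm Z O R (n1 * 1)).
Hypotheses (m0 : (0 < m)%N) (b0 : (0 < b)%N) (eps0 : 0 <= eps).
Hypothesis Adp : user_level_DP eps delta' A.
Hypothesis Auseful : useful T gamma A.
Hypothesis room : (n1 * 1 * b + K * m <= n * m)%N.
Variables (e c beta e2 d2 : R) (p : nat -> R).
Hypotheses (e1 : 1 <= e) (c0 : 0 <= c) (beta0 : 0 <= beta).
Hypothesis conc : forall s (F : seq bool -> O -> R), (s <= K * m)%N ->
  (forall t o, 0 <= F t o) -> (forall t, \sum_o F t o = 1) ->
  (forall t t', size t = s -> adj t t' ->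
    indist (1 + (expR eps - 1) / b%:R) (delta' / b%:R) (F t) (F t')) ->
  cavg s (fun t => (~~ (indist e c (F t) (F (map negb t))
    && indist e c (F (map negb t)) (F t)))%:R) <= beta.
Hypotheses (e21 : 1 <= e2) (d20 : 0 <= d2).
Hypothesis p01 : forall i, 0 <= p i <= 1.
Hypothesis p0 : p 0 = 1.
Hypothesis pk : forall i, (k <= i)%N -> p i = 0.
Hypothesis kK : (k.*2 <= K)%N.
Hypothesis pstep : forall i j, (i <= j.+1)%N -> (j <= i.+1)%N ->
  p i <= e2 * p j + d2 /\ 1 - p i <= e2 * (1 - p j) + d2.
Hypothesis He : e2 * (e * e * (e * e)) <= expR eps.
Hypothesis Hd : e2 * (e * e * (e * c + c) + (e * c + c)) + 2 * d2 <= delta.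

Lemma item_level_indist l (t t' : (n1 * 1).-tuple Z) :
  (forall l', l' != l -> tnth t l' = tnth t' l') ->
  indist (expR eps) delta' (A t) (A t').
Proof.
move=> tt'; apply/indistP => S; apply: Adp.
exists (cast_ord (muln1 _) l) => j; rewrite divn1 => jl.
by apply: tt'; apply: contra jl => /eqP ->.
Qed.

(** Two algorithms [B V] and [B V'] are compared through the empty set, and two deleted sets through
    a common superset, whence the fourth power of [e] in [He]. The union bound pays [beta] for each
    set of at most [K] users. *)
Lemma transfer : achievable T m eps delta (gamma - (n.+1 ^ K)%:R * beta) n.
Proof.
(* The replacements depend on [V] alone, not on the data. *)
have [rep repP] := choice (exists_replacement m0 b0 room).
pose it := item room.
pose B (V : {set 'I_n}) := block_algorithm b0 A (fun l c => rep V (it l c)).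
have usedit l c' : it l c' \in used room by apply/imsetP; exists (l, c').
have Blocal (V : {set 'I_n}) (x x' : (n * m).-tuple Z) : (#|V| <= K)%N ->
    (forall i : 'I_(n * m), (forall u : 'I_n, u \in V -> (i %/ m)%N != u) ->
      tnth x i = tnth x' i) -> B V x =1 B V x'.
  move=> VK xx' o; have [_ r1 r2] := repP V VK.
  congr (block_sample A _ o); apply/funext => l; apply/funext => c'.
  apply: xx' => u uV.
  have : rep V (it l c') \notin owned m V.
    have [iV|iV] := boolP (it l c' \in owned m V); last by rewrite r2.
    have := r1 (it l c'); rewrite finset.in_setI usedit iV => /(_ isT).
    by rewrite finset.in_setU negb_or => /andP[].
  apply: contra => iu; rewrite inE; apply/existsP; exists u.
  by rewrite uV.
have B0 x : B finset.set0 x =1 block_prob A it x.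
  move=> o; have [|_ _ r2] := repP finset.set0; first by rewrite cards0.
  congr (block_sample A _ o); apply/funext => l; apply/funext => c'.
  rewrite r2 // inE; apply/existsP => -[u].
  by rewrite inE.
have ce0 : 0 <= e by exact: le_trans e1.
have cc0 : 0 <= e * c + c by rewrite addr_ge0 // mulr_ge0.
have e2e : 1 <= e * e by exact: mulr_ege1.
(* The fallback output must be independent of the input, so [A] is run on a fixed point. *)
pose C := out_prob A point.
have C0 o : 0 <= C o by exact: out_prob_ge0.
have C1 : \sum_o C o = 1 by exact: out_prob_sum1.
pose M := ptr K B (e * e) (e * c + c) C0 C1 p01.
exists M; split; first by apply: (ptr_DP Blocal) pk kK pstep _ _ _ _ => //.
pose sep (V : {set 'I_n}) := separated A it (rep V) e c.
have sepP (V : {set 'I_n}) (x : (n * m).-tuple Z) : ~~ sep V x ->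
    indist e c (B finset.set0 x) (B V x) /\ indist e c (B V x) (B finset.set0 x).
  rewrite /sep /separated negbK => /andP[].
  by rewrite !(eq_indist _ _ (B0 x) (frefl _)) !(eq_indist _ _ (frefl _) (B0 x)).
have stab (x : (n * m).-tuple Z) :
    (forall V : {set 'I_n}, (#|V| <= K)%N -> ~~ sep V x) ->
    stable K B (e * e) (e * c + c) x finset.set0.
  move=> H; apply/stableP => V V' _ _ VK V'K.
  have [_ h1] := sepP _ _ (H _ VK); have [h2 _] := sepP _ _ (H _ V'K).
  exact: indist_trans h1 h2.
move=> D vD; set S := correct T D.
have msep V : measurable_fun [set: (n * m).-tuple Z] (fun x => (sep V x)%:R : R).
  by apply: measurable_natr_bool; exact: measurable_separated.
have isep (V : {set 'I_n}) : (#|V| <= K)%N ->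
    (\int[iid D (n * m)]_x ((sep V x)%:R)%:E <= beta%:E)%E.
  move=> VK; have [r0 r1 r2] := repP V VK.
  apply: (@separated_whp _ _ _ _ _ _ _ b0 _ (expR eps) delta' _ _
    (used room :&: owned m V)) => //.
  - by rewrite -expR0 ler_expR.
  - exact: item_level_indist.
  - exact: item_inj.
  - by move=> i; rewrite finset.in_setI => /andP[/imsetP[[l c'] _ ->] _]; exists l, c'.
  - move=> i /r1; rewrite finset.in_setU finset.in_setI negb_or => /andP[/negPf -> _].
    by [].
  - by move=> l c'; rewrite finset.in_setI usedit /= => /r2; apply; exact: usedit.
  - move=> F; apply: conc; apply: leq_trans (subset_leq_card (finset.subsetIr _ _)) _.
    by apply: leq_trans (card_owned m0 V) _; rewrite leq_mul2r VK orbT.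
have mPr (A' : algorithm Z O R (n * m)) :
    measurable_fun [set: (n * m).-tuple Z] (fun x => (Pr_in A' x S)%:E).
  apply/measurable_EFinP; apply: measurable_sum_in; exact: measurable_out_prob.
have Pr0 (A' : algorithm Z O R (n * m)) x : 0 <= Pr_in A' x S.
  by apply: sumr_ge0 => o _; exact: out_prob_ge0.
rewrite EFinB leeBlDr //.
apply: (@le_trans _ _ (\int[iid D (n * m)]_x (Pr_in (block_algorithm b0 A it) x S)%:E)%E).
  rewrite integral_block; first exact: Auseful.
  exact: item_inj.
(* [bad] counts the separated sets. Where it is 0, [M] and the block algorithm have the same output
   law; elsewhere it is at least 1, which dominates any probability. *)
pose bad x : R := \sum_(V : {set 'I_n} | (#|V| <= K)%N) (sep V x)%:R.
have mbad : measurable_fun [set: (n * m).-tuple Z] (fun x => (bad x)%:E).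
  apply/measurable_EFinP.
  rewrite (_ : bad = fun x => \sum_(V : {set 'I_n})
    if (#|V| <= K)%N then (sep V x)%:R else 0).
    by apply: measurable_sum => V; case: (leqP #|V| K).
  by apply/funext => x; rewrite /bad big_mkcond.
have bad0 x : 0 <= bad x by exact: sumr_ge0.
apply: (@le_trans _ _ (\int[iid D (n * m)]_x ((Pr_in M x S)%:E + (bad x)%:E))%E).
  apply: ge0_le_integral => //.
  - by move=> x _; rewrite lee_fin.
  - exact: emeasurable_funD.
  move=> x _; rewrite -EFinD lee_fin.
  have [/forallP H|] := boolP [forall V : {set 'I_n}, (#|V| <= K)%N ==> ~~ sep V x].
    apply: (@le_trans _ _ (Pr_in M x S)); last by rewrite lerDl.
    rewrite le_eqVlt; apply/orP; left; apply/eqP; apply: eq_bigr => o _.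
    rewrite ptr_stable ?B0 //.
    by apply: stab => V VK; exact: (implyP (H V)).
  rewrite negb_forall => /existsP[V]; rewrite negb_imply negbK => /andP[VK sV].
  rewrite /bad (bigD1 V) //= sV.
  apply: (@le_trans _ _ 1).
    rewrite -(out_prob_sum1 (block_algorithm b0 A it) x).
    rewrite [leRHS](bigID (fun o => o \in S)) /= lerDl.
    by apply: sumr_ge0 => o _; exact: (out_prob_ge0 (block_algorithm b0 A it)).
  by rewrite addrCA lerDl addr_ge0 // sumr_ge0.
rewrite ge0_integralD //; last 2 first.
  by move=> x _; rewrite lee_fin.
  by move=> x _; rewrite lee_fin.
rewrite leeD2l //.
have badE x : (bad x)%:E = (\sum_(V : {set 'I_n})
    if (#|V| <= K)%N then ((sep V x)%:R)%:E else 0)%E.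
  by rewrite /bad -sumEFin big_mkcond.
rewrite (eq_integral _ _ (fun x _ => badE x)).
rewrite ge0_integral_sum //; last 2 first.
  by move=> V; case: (#|V| <= K)%N => //; exact/measurable_EFinP.
  by move=> V x _; case: (#|V| <= K)%N; rewrite lee_fin.
apply: (@le_trans _ _ (\sum_(V : {set 'I_n}) if (#|V| <= K)%N then beta%:E else 0)%E).
  apply: lee_sum => V _; case VK: (#|V| <= K)%N; first exact: isep.
  by rewrite integral0.
rewrite -big_mkcond sumEFin lee_fin sumr_const -[leLHS]mulr_natl ler_wpM2r //.
rewrite ler_nat; apply: leq_trans (card_small_sets n K).
by rewrite cardsE.
Qed.

End transfer.

(** * Numerical estimates *)

(** For [1 / (1 + D * e ^ i)] the odds change by the factor [e] at each step, so the probability and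
    its complement change by a factor of at most [e]. Putting 1 at 0, and 0 from [k.+2] on, costs at
    most [d] at each end. *)
Lemma exists_acceptance (R : realFieldType) (e d D : R) (k : nat) :
  1 <= e -> 0 < D -> D * e <= d -> d^-1 <= D * e ^+ k.+1 ->
  exists p : nat -> R, [/\ forall i, 0 <= p i <= 1, p 0 = 1,
    forall i, (k.+2 <= i)%N -> p i = 0 &
    forall i j, (i <= j.+1)%N -> (j <= i.+1)%N ->
      p i <= e * p j + d /\ 1 - p i <= e * (1 - p j) + d].
Proof.
move=> e1 D0 Ded dDe; have e0 : 0 < e by lra.
have d0 : 0 < d by apply: lt_le_trans Ded; rewrite mulr_gt0.
pose a i := D * e ^+ i; have a0 i : 0 < a i by rewrite mulr_gt0 ?exprn_gt0.
pose q i := (1 + a i)^-1.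
have q0 i : 0 < q i by rewrite invr_gt0 addr_gt0.
have qa i : q i * (1 + a i) = 1 by rewrite mulVf // gt_eqF // addr_gt0.
have q1 i : q i <= 1 by have := qa i; have := q0 i; have := a0 i; nra.
have aS i : a i.+1 = e * a i by rewrite /a exprS mulrCA.
have qS i : q i.+1 <= q i.
  rewrite lef_pV2 ?posrE ?addr_gt0 // lerD2l aS; have := a0 i; nra.
have qS' i : q i <= e * q i.+1.
  have p1 : 0 < 1 + a i by rewrite addr_gt0.
  have p2 : 0 < 1 + e * a i by rewrite addr_gt0 // mulr_gt0.
  rewrite /q aS -[leLHS]mul1r ler_pdivrMr // mulrAC ler_pdivlMr //.
  have := a0 i; nra.
have cqS i : 1 - q i.+1 <= e * (1 - q i).
  have -> : 1 - q i.+1 = e * a i * q i.+1 by have := qa i.+1; rewrite aS; lra.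
  have -> : 1 - q i = a i * q i by have := qa i; lra.
  by rewrite -mulrA ler_wpM2l ?(ltW e0) // ler_wpM2l ?(ltW (a0 i)).
have near1 : 1 - q 1 <= d.
  have := qa 1; rewrite aS /a expr0 mulr1 mulrDr mulr1.
  have : q 1 * (e * D) <= e * D by rewrite ler_piMl // mulr_ge0 // ltW.
  by move: Ded; rewrite mulrC; lra.
have qk : q k.+1 <= d.
  rewrite /q invf_ple ?posrE ?addr_gt0 //; apply: le_trans dDe _.
  by rewrite -/(a k.+1); lra.
pose p i := if i == 0%N then 1 else if (k.+2 <= i)%N then 0 else q i.
have p01 i : 0 <= p i <= 1.
  rewrite /p; case: (i == 0)%N; first by rewrite ler01 lexx.
  by case: (k.+2 <= i)%N; rewrite ?lexx ?ler01 // q1 (ltW (q0 i)).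
have pstep i : [/\ p i.+1 <= e * p i + d, p i <= e * p i.+1 + d,
    1 - p i.+1 <= e * (1 - p i) + d & 1 - p i <= e * (1 - p i.+1) + d].
  have E x y : x <= y -> 0 <= y -> x <= e * y + d by nra.
  case: i => [|i].
    have qd0 : 0 <= 1 - q 1 by rewrite subr_ge0.
    by rewrite /p /= subrr; have := q0 1%N; have := q1 1%N; split; nra.
  have := q0 i.+1; have := q1 i.+1; have := q0 i.+2; have := q1 i.+2.
  rewrite /p /= !ltnS; have [ki|ik] := leqP k.+1 i.
    by rewrite (ltnW ki); move=> *; split; nra.
  have [ki|ik'] := leqP k i.
    have -> : i = k by apply/eqP; rewrite eqn_leq ki -ltnS ik.
    by rewrite subr0; move: qk => *; split; nra.
  have := qS i.+1; have := qS' i.+1; have := cqS i.+1; move=> *; split; nra.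
exists p; split => //.
- by move=> i ki; rewrite /p ki; case: i ki.
move=> i j ij ji; have [ij'|ji'|->] := ltngtP i j.
- have -> : j = i.+1 by apply/eqP; rewrite eqn_leq ji ij'.
  by have [] := pstep i.
- have -> : i = j.+1 by apply/eqP; rewrite eqn_leq ij ji'.
  by have [] := pstep j.
- by have /andP[x0 x1] := p01 j; split; nra.
Qed.

Section moments.
Context (R : realType).
Implicit Types h y : R.

(** This follows from [(1 - y) * expR y <= 1], as [1 - y] times the right side is
    [1 + y ^+ 2 * (1 - 2 * y)]. *)
Lemma expR_le_quad y : `|y| <= 1 / 2 -> expR y <= 1 + y + 2 * y ^+ 2.
Proof.
rewrite ler_norml => /andP[y1 y2].
have e1 := expR_ge1Dx (- y); have e2 : expR (- y) * expR y = 1.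
  by rewrite -expRD addNr expR0.
have E0 : 0 < expR y by exact: expR_gt0.
move: (expR y) (expR (- y)) e1 e2 E0 => E F e1 e2 E0.
have h1 : (1 - y) * E <= 1 by rewrite -[leRHS]e2; apply: ler_wpM2r => //; exact: ltW.
rewrite -(ler_pM2l (_ : 0 < 1 - y)); last by lra.
apply: le_trans h1 _; nra.
Qed.

Lemma inv_1D_le_expR h : `|h| <= 1 / 2 -> (1 + h)^-1 <= expR (- h + 2 * h ^+ 2).
Proof.
rewrite ler_norml => /andP[h1 h2].
apply: le_trans (expR_ge1Dx _).
rewrite -(ler_pM2l (_ : 0 < 1 + h)); last by lra.
rewrite mulfV; last by rewrite gt_eqF //; lra.
nra.
Qed.

(** The terms linear in [h] cancel between [1 + h] and [1 - h]. A step thus costs the square of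
    [P%:R * c], and [s] steps stay bounded when that product is of order [1 / sqrt s]. The constant
    7 is shared with [moment_down]. *)
Lemma moment_up (c h : R) (P : nat) : P%:R * c <= 1 / 4 -> c <= 1 / 4 ->
  `|h| <= c -> ((1 + h) ^+ P + (1 - h) ^+ P) / 2 <= 1 + 7 * (P%:R * c) ^+ 2.
Proof.
move=> Pc c4 hc.
have Ph : `|P%:R * h| <= P%:R * c by rewrite normrM normr_nat ler_wpM2l.
have b (x : R) : `|x| <= c -> `|P%:R * x| <= P%:R * c ->
    (1 + x) ^+ P <= 1 + P%:R * x + 2 * (P%:R * x) ^+ 2.
  move=> xc Px; apply: le_trans (expR_le_quad _); last by lra.
  rewrite mulrC expRM_natr lerXn2r ?nnegrE ?expR_ge0 ?expR_ge1Dx //.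
  by move: xc; rewrite ler_norml; lra.
have := b h hc Ph; have := b (- h); rewrite normrN mulrN normrN => /(_ hc Ph).
have : (P%:R * h) ^+ 2 <= (P%:R * c) ^+ 2.
  by rewrite -[leLHS]real_normK ?num_real // lerXn2r ?nnegrE //; apply: le_trans Ph.
rewrite sqrrN; have := sqr_ge0 (P%:R * c); lra.
Qed.

Lemma moment_down (c h : R) (P : nat) : P%:R * c <= 1 / 4 -> c <= 1 / 4 ->
  (0 < P)%N -> `|h| <= c ->
  ((1 + h) ^- P + (1 - h) ^- P) / 2 <= 1 + 7 * (P%:R * c) ^+ 2.
Proof.
move=> Pc c4 P0 hc.
have P1 : 1 <= P%:R :> R by rewrite ler1n.
have Ph : `|P%:R * h| <= P%:R * c by rewrite normrM normr_nat ler_wpM2l.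
have c0 : 0 <= c by apply: le_trans hc.
set z := P%:R * c in Pc Ph *.
have z0 : 0 <= z by rewrite mulr_ge0.
have h2 : h ^+ 2 <= c ^+ 2.
  by rewrite -[leLHS]real_normK ?num_real // lerXn2r ?nnegrE.
have h20 := sqr_ge0 h.
have Ph2 : P%:R * h ^+ 2 <= z ^+ 2.
  apply: (@le_trans _ _ (P%:R * c ^+ 2)); first by rewrite ler_wpM2l.
  by rewrite /z exprMn ler_wpM2r ?sqr_ge0 // expr2 ler_peMl.
have Ph20 : 0 <= P%:R * h ^+ 2 by rewrite mulr_ge0.
have zz : (P%:R * h) ^+ 2 <= z ^+ 2.
  by rewrite -[leLHS]real_normK ?num_real // lerXn2r ?nnegrE.
have b (x : R) : `|x| <= c -> x ^+ 2 = h ^+ 2 -> `|P%:R * x| <= z ->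
    (1 + x) ^- P <= 1 + (- (P%:R * x) + 2 * (P%:R * h ^+ 2)) +
      2 * (- (P%:R * x) + 2 * (P%:R * h ^+ 2)) ^+ 2.
  move=> xc xh Px; apply: le_trans (expR_le_quad _); last first.
    by move: Px; rewrite !ler_norml; move: Ph20 Ph2; nra.
  rewrite -mulrN mulrCA -mulrDr mulrC expRM_natr -exprVn lerXn2r ?nnegrE ?expR_ge0 //.
    by rewrite invr_ge0; move: xc; rewrite ler_norml; lra.
  by rewrite -xh; apply: inv_1D_le_expR; lra.
have := b h hc erefl Ph.
have := b (- h); rewrite normrN mulrN normrN sqrrN => /(_ hc erefl Ph).
move: zz Ph2 Ph20 z0 Pc; set u := P%:R * h; set v := P%:R * _ => zz Ph2 Ph20 z0 Pc.
have z16 : z ^+ 2 <= 1 / 16 by nra.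
have vz : v * v <= z ^+ 2 / 16.
  apply: (@le_trans _ _ (v * (1 / 16))); last by lra.
  by rewrite ler_wpM2l //; lra.
clearbody u v z; rewrite opprK; nra.
Qed.

(** The left side is [cosh (a / 2) ^+ 2], which exceeds 1 to second order only. For large [a], the
    bound [expR a] suffices. *)
Lemma blowup_factor (a : R) : 0 <= a ->
  (2 + expR a + (expR a)^-1) / 4 <= expR (4 * a ^+ 2).
Proof.
move=> a0; have [a1|a1] := leP a (1 / 2).
  have := @expR_le_quad a; have := @expR_le_quad (- a).
  rewrite normrN ger0_norm // sqrrN expRN => /(_ a1) h1 /(_ a1) h2.
  apply: le_trans (expR_ge1Dx _); have := sqr_ge0 a; lra.
apply: (@le_trans _ _ (expR a)); last by rewrite ler_expR; nra.
have : 1 <= expR a by rewrite -expR0 ler_expR.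
have : (expR a)^-1 <= 1 by rewrite -expRN -expR0 ler_expR; lra.
by lra.
Qed.

End moments.

Section concentration.
Context (R : realType) (O : finType).

(** Here [E] bounds the dimension. The loss [eps / 16] is halved between group privacy over [r]
    flips and the ratio [g] to the mean. The lower bound on [b], of order [l * sqrt E], keeps the
    moments over all steps at most 2. *)
Lemma cube_concentration (eps delta delta' l : R) (E b s : nat)
    (F : seq bool -> O -> R) :
  0 < eps <= 1 / 2 -> 0 < delta <= 2 ^- 13 -> 0 <= delta' -> 1 <= l ->
  delta * expR l = 1 -> (0 < E)%N ->
  (2 ^+ 9 * l) ^+ 2 * E%:R <= b%:R ^+ 2 -> E%:R * delta' <= delta / 2 ^+ 13 ->
  (s <= E)%N ->
  (forall t o, 0 <= F t o) -> (forall t, \sum_o F t o = 1) ->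
  (forall t t', size t = s -> adj t t' ->
    indist (1 + (expR eps - 1) / b%:R) (delta' / b%:R) (F t) (F t')) ->
  cavg s (fun t => (~~ (
      indist (expR (eps / 16) * expR (eps / 16))
        (expR (eps / 16) * (delta / 2 ^+ 7) + delta / 2 ^+ 7) (F t) (F (map negb t)) &&
      indist (expR (eps / 16) * expR (eps / 16))
        (expR (eps / 16) * (delta / 2 ^+ 7) + delta / 2 ^+ 7) (F (map negb t)) (F t)))%:R)
  <= 4 * expR (- ((b %/ 64)%:R ^+ 2 / (16 * E%:R))) :> R.
Proof.
move=> /andP[eps0 eps2] /andP[delta0 delta2] delta'0 l1 dl E0 hb hd sE F0 F1 Fdp.
set eh := expR (eps / 16); set r := (b %/ 64)%N.
have E1 : 1 <= E%:R :> R by rewrite ler1n.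
have lb : 2 ^+ 9 * l <= b%:R.
  rewrite -(@ler_pXn2r _ 2) ?nnegrE ?mulr_ge0 //; last by lra.
  by apply: le_trans hb; rewrite ler_peMr // sqr_ge0.
have b512 : 2 ^+ 9 <= b%:R :> R by apply: le_trans lb; rewrite ler_peMr.
have b0 : 0 < b%:R :> R by lra.
have r64 : 64 * r%:R <= b%:R :> R.
  by rewrite -natrM ler_nat mulnC leq_trunc_div.
have r0 : 0 < r%:R :> R.
  rewrite ltr0n divn_gt0 // -(ler_nat R); apply: le_trans b512; lra.
have e2 : expR eps - 1 <= 2 * eps.
  have : expR eps <= 1 + eps + 2 * eps ^+ 2.
    by apply: expR_le_quad; rewrite ger0_norm // ltW.
  by nra.
have e0 : 0 <= expR eps - 1 by rewrite subr_ge0 -expR0 ler_expR ltW.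
set ee := 1 + (expR eps - 1) / b%:R in Fdp *.
have ee1 : 1 <= ee by rewrite lerDl divr_ge0 // ltW.
have eer : ee ^+ r <= expR (eps / 32).
  apply: (@le_trans _ _ (expR (2 * eps / b%:R) ^+ r)).
    rewrite lerXn2r ?nnegrE ?expR_ge0 //; first by lra.
    apply: le_trans (expR_ge1Dx _); rewrite lerD2l; apply: ler_wpM2r => //.
  rewrite -expRM_natl ler_expR mulrA ler_pdivrMr //.
  by move: r64 eps0; nra.
pose g := expR (eps / 32).
have small (y : R) : 0 <= y -> y <= 1 / 2 -> 1 <= expR y <= 2.
  move=> y0 y1; rewrite -{1}expR0 ler_expR y0 /=.
  apply: (@le_trans _ _ (1 + y + 2 * y ^+ 2)); last by nra.
  by apply: expR_le_quad; rewrite ger0_norm.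
have /andP[g1 g2] : 1 <= g <= 2 by apply: small; lra.
(* With this [p], [g ^+ p] is at least [delta ^- 2], so the tail is small against [delta]. *)
pose p := (Num.truncn (64 * l / eps)).+1.
have le0 : 1 <= l / eps by rewrite ler_pdivlMr //; lra.
have p1 : 64 * (l / eps) <= p%:R.
  by rewrite mulrA ltW // truncnS_gt.
have p2 : p.+1%:R <= 66 * (l / eps).
  have : (Num.truncn (64 * l / eps))%:R <= 64 * l / eps.
    by rewrite truncn_le divr_ge0 //; lra.
  by rewrite -!natr1; lra.
pose c' := eps / b%:R.
have c'0 : 0 <= c' by rewrite divr_ge0 // ltW.
have Pc : p.+1%:R * c' <= 66 * l / b%:R.
  apply: (@le_trans _ _ (66 * (l / eps) * c')); first by rewrite ler_wpM2r.
  rewrite /c' le_eqVlt; apply/orP; left; apply/eqP; field.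
  by rewrite !gt_eqF.
have lb4 : 66 * l / b%:R <= 1 / 4 by rewrite ler_pdivrMr //; lra.
have Pc4 : p.+1%:R * c' <= 1 / 4 by lra.
have c4 : c' <= 1 / 4.
  by apply: le_trans Pc4; rewrite ler_peMl // ler1n.
pose L := 1 + 7 * (p.+1%:R * c') ^+ 2.
have L1 : 1 <= L by rewrite lerDl mulr_ge0 // sqr_ge0.
have Ls : L ^+ s <= 2.
  apply: (@le_trans _ _ (L ^+ E)); first by rewrite ler_weXn2l.
  apply: (@le_trans _ _ (expR (7 * (p.+1%:R * c') ^+ 2) ^+ E)).
    by rewrite lerXn2r ?nnegrE ?expR_ge0 ?expR_ge1Dx //; lra.
  rewrite -expRM_natl.
  have z0 : 0 <= p.+1%:R * c' by rewrite mulr_ge0.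
  have h : E%:R * (7 * (p.+1%:R * c') ^+ 2) <= 1 / 2.
    have h1 : (p.+1%:R * c') ^+ 2 <= (66 * l / b%:R) ^+ 2.
      by rewrite lerXn2r ?nnegrE //; lra.
    have h2 : (66 * l / b%:R) ^+ 2 * E%:R <= 1 / 16.
      rewrite expr_div_n mulrAC ler_pdivrMr ?exprn_gt0 //.
      have : 0 <= l ^+ 2 * E%:R by rewrite mulr_ge0 // sqr_ge0.
      by move: hb; rewrite !exprMn; lra.
    have := ler_wpM2r (ler0n R E) h1; lra.
  have [] // := andP (small _ _ h); rewrite mulr_ge0 // mulr_ge0 //; exact: sqr_ge0.
have d20 : 0 <= delta' / b%:R by rewrite divr_ge0 // ltW.
have dd' : delta' / b%:R <= delta'.
  by rewrite ler_pdivrMr // ler_peMr //; lra.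
have delta'1 : delta' <= delta / 2 ^+ 13.
  by apply: le_trans hd; rewrite ler_peMl.
have tot : (1 + g) * (s%:R * (delta' / b%:R)) + 2 * (L ^+ s / g ^+ p) <=
    delta / 2 ^+ 9 / 2.
  have t1 : (1 + g) * (s%:R * (delta' / b%:R)) <= 3 * (delta / 2 ^+ 13).
    apply: ler_pM; [lra|by rewrite mulr_ge0|lra|].
    apply: le_trans hd; apply: ler_pM => //; by rewrite ler_nat.
  have t2 : L ^+ s / g ^+ p <= 2 * delta ^+ 2.
    have gp : expR l ^+ 2 <= g ^+ p.
      rewrite /g -!expRM_natl ler_expR.
      have : eps * (l / eps) = l by rewrite mulrCA divff ?mulr1 // gt_eqF.
      by have := ler_wpM2l (ltW eps0) p1; lra.
    have l0 : 0 < expR l ^+ 2 by rewrite exprn_gt0 // expR_gt0.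
    have gp0 : 0 < g ^+ p by exact: lt_le_trans gp.
    have -> : delta = (expR l)^-1.
      by apply: (mulIf (x := expR l)); rewrite ?dl ?mulVf // gt_eqF // expR_gt0.
    rewrite exprVn; apply: ler_pM => //.
    - by rewrite exprn_ge0 //; lra.
    - by rewrite invr_ge0 ltW.
    - by rewrite lef_pV2.
  by move: delta0 delta2; nra.
(* This minimizes [4 * lam ^+ 2 * E - lam * r], with value [- r ^+ 2 / (16 * E)]. *)
pose lam : R := r%:R / (8 * E%:R).
have lam0 : 0 < lam by rewrite divr_gt0 // mulr_gt0 //; lra.
have eh1 : ee ^+ r * g <= eh.
  apply: (@le_trans _ _ (expR (eps / 32) * g)).
    by rewrite ler_wpM2r //; lra.
  by rewrite /g -expRD ler_expR; lra.
have dh1 : ee ^+ r * (delta / 2 ^+ 9) + g * (r%:R * ee ^+ r * (delta' / b%:R)) <=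
    delta / 2 ^+ 7.
  have er2 : ee ^+ r <= 2 by rewrite (le_trans eer).
  have er0 : 0 <= ee ^+ r by rewrite exprn_ge0 //; lra.
  have rb : r%:R * (delta' / b%:R) <= delta'.
    rewrite mulrCA ler_piMr // ler_pdivrMr //; lra.
  have rb0 : 0 <= r%:R * (delta' / b%:R) by rewrite mulr_ge0.
  have x1 : ee ^+ r * (r%:R * (delta' / b%:R)) <= 2 * delta' by exact: ler_pM.
  have x2 : g * (r%:R * ee ^+ r * (delta' / b%:R)) <= 2 * (2 * delta').
    apply: ler_pM => //; [lra|by rewrite !mulr_ge0|].
    by rewrite [r%:R * _]mulrC -mulrA.
  have x3 : ee ^+ r * (delta / 2 ^+ 9) <= 2 * (delta / 2 ^+ 9).
    by rewrite ler_wpM2r //; lra.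
  lra.
have A1 : 1 < expR lam by rewrite -expR0 ltr_expR.
have c'e : (ee - 1) / 2 <= c'.
  rewrite /ee /c' [1 + _]addrC addrK ler_pdivrMr // mulrAC ler_wpM2r //.
  by lra.
apply: le_trans (opposite_whp (c := c') (L := L) (g := g) (dg := delta / 2 ^+ 9)
  (p := p) (r := r) (A := expR lam) (eh := eh) (dh := delta / 2 ^+ 7)
  d20 ee1 F0 F1 Fdp c'e _ _ _ g1 _ tot A1 eh1 dh1) _.
- by lra.
- by move=> h hc; exact: moment_up.
- by move=> h hc; exact: moment_down.
- by lra.
rewrite -mulrA ler_pM2l //.
have bf := blowup_factor (ltW lam0); set La := (_ / 4) in bf *.
have La1 : 1 <= La.
  rewrite /La; set x := expR lam in A1 *.
  have xx : x * x^-1 = 1 by rewrite mulfV // gt_eqF //; lra.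
  have x'0 : 0 < x^-1 by rewrite invr_gt0; lra.
  by nra.
apply: (@le_trans _ _ (expR (4 * lam ^+ 2) ^+ E / expR lam ^+ r)).
  rewrite ler_wpM2r ?invr_ge0 ?exprn_ge0 ?expR_ge0 //.
  apply: (@le_trans _ _ (La ^+ E)); first by rewrite ler_weXn2l.
  by rewrite lerXn2r ?nnegrE ?expR_ge0 //; lra.
rewrite -!expRM_natl -expRN -expRD ler_expR le_eqVlt; apply/orP; left; apply/eqP.
by rewrite /lam; field; rewrite gt_eqF //; lra.
Qed.

End concentration.

(** * Arithmetic of the block size and the number of users *)

Section parameters.
(** Intended values: [l] is the logarithm of [delta^-1], [a] is [l / eps], [u] is
    [l ^ (3 / 2) / eps], [s] is the root of [m], [f] is the expression inside the soft-O, [Y] is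
    [ln f], and [r] is [b / 64] rounded down. *)
Context (R : realFieldType) (l a u s Y f m K b r n1 n : R).
Hypotheses (l1 : 1 <= l) (a17 : 2 ^+ 17 <= a) (la : l <= a) (au : a <= u).
Hypotheses (uu : u ^+ 2 = l * a ^+ 2) (s1 : 1 <= s) (sm : s ^+ 2 = m).
Hypotheses (n10 : 0 <= n1) (fE : f = a + u * n1 / s) (Y1 : 1 <= Y) (Yf : Y <= f).
Hypotheses (K1 : 1 <= K) (Ka : K <= 14 * a).
Hypotheses (b1 : 2 ^+ 15 * (s * u * Y) <= b) (b2 : b <= 2 ^+ 15 * (s * u * Y) + 1).

Let suY : 0 <= s * u * Y.
Proof. by rewrite !mulr_ge0 //; move: s1 Y1 a17 au; lra. Qed.

Let bb : 2 ^+ 30 * (m * (l * a ^+ 2) * Y ^+ 2) <= b ^+ 2.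
Proof.
rewrite -uu -sm (_ : 2 ^+ 30 * _ = (2 ^+ 15 * (s * u * Y)) ^+ 2); last by ring.
by rewrite lerXn2r ?nnegrE //; [rewrite mulr_ge0|apply: le_trans b1; rewrite mulr_ge0].
Qed.

Let m0 : 0 < m.
Proof. by rewrite -sm exprn_gt0 //; move: s1; lra. Qed.

Let YY : Y <= Y ^+ 2.
Proof. by rewrite expr2 ler_peMl //; move: Y1; lra. Qed.

Lemma block_size_moment : (2 ^+ 9 * l) ^+ 2 * (K * m) <= b ^+ 2.
Proof.
apply: le_trans bb.
have h1 : K * 1 <= 14 * a * Y ^+ 2.
  by apply: ler_pM => //; move: K1 Y1 YY; lra.
have h2 : l * K <= 14 * a * Y ^+ 2 * a.
  by rewrite [l * K]mulrC; apply: ler_pM; move: h1 K1 l1 la; lra.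
have ml : 0 <= m * l by rewrite mulr_ge0 ?(ltW m0) //; move: l1; lra.
have mlaY : 0 <= m * l * (a ^+ 2 * Y ^+ 2) by rewrite mulr_ge0 // mulr_ge0 // sqr_ge0.
have := ler_wpM2l ml h2; lra.
Qed.

Lemma blowup_radius : b / 2 ^+ 7 <= r -> 5 * (K * Y) <= r ^+ 2 / (16 * (K * m)).
Proof.
move=> br; have K0 : 0 < K by move: K1; lra.
rewrite ler_pdivlMr ?mulr_gt0 //.
have b0 : 0 <= b by apply: le_trans b1; rewrite mulr_ge0.
have r2 : b ^+ 2 / 2 ^+ 14 <= r ^+ 2.
  rewrite (_ : _ / _ = (b / 2 ^+ 7) ^+ 2); last by field.
  have x0 : 0 <= b / 2 ^+ 7 by rewrite divr_ge0.
  by rewrite lerXn2r ?nnegrE //; apply: le_trans br.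
apply: le_trans r2; rewrite ler_pdivlMr ?exprn_gt0 //; apply: le_trans bb.
have K2 : K ^+ 2 <= (14 * a) ^+ 2.
  by rewrite lerXn2r ?nnegrE ?(ltW K0) //; move: K0 Ka; lra.
have a20 := sqr_ge0 a.
have h1 : K ^+ 2 * Y <= (14 * a) ^+ 2 * Y ^+ 2.
  by apply: ler_pM => //; [exact: sqr_ge0|move: Y1; lra].
have Y20 := sqr_ge0 Y.
have h2 : a ^+ 2 * Y ^+ 2 <= l * a ^+ 2 * Y ^+ 2.
  by rewrite -mulrA ler_peMl // mulr_ge0.
have h3 : 5 * 16 * 2 ^+ 14 * (K ^+ 2 * Y) <= 2 ^+ 30 * (l * a ^+ 2 * Y ^+ 2).
  have aY : 0 <= a ^+ 2 * Y ^+ 2 by rewrite mulr_ge0.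
  by move: h1 h2; rewrite exprMn; lra.
have := ler_wpM2l (ltW m0) h3; lra.
Qed.

Hypothesis nK : n <= K + n1 * b / m + 1.

Lemma users_le : n + 1 <= 2 ^+ 16 * f * Y.
Proof.
have s0 : 0 < s by move: s1; lra.
have u0 : 0 <= u by move: a17 au; lra.
have us : 0 <= u * n1 / s by rewrite !mulr_ge0 // invr_ge0 ltW.
have a0 : 0 <= a by move: a17; lra.
have af : a <= f by rewrite fE lerDl.
have f1 : 2 ^+ 17 <= f by exact: le_trans af.
have uf : u * n1 / s <= f by rewrite fE lerDr.
have x1 : n1 * b / m <= 2 ^+ 15 * (u * n1 / s) * Y + n1 / m.
  apply: (@le_trans _ _ (n1 * (2 ^+ 15 * (s * u * Y) + 1) / m)).
    by rewrite ler_wpM2r ?invr_ge0 ?(ltW m0) // ler_wpM2l.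
  rewrite -sm le_eqVlt; apply/orP; left; apply/eqP; field.
  by rewrite gt_eqF.
have x2 : n1 / m <= u * n1 / s.
  rewrite -sm expr2 invfM mulrA ler_wpM2r ?invr_ge0 ?(ltW s0) //.
  rewrite [u * n1]mulrC ler_wpM2l // (@le_trans _ _ 1) ?invf_le1 //.
  by move: a17 au; lra.
have f0 : 0 <= f by apply: le_trans f1; rewrite exprn_ge0.
have x3 : 2 ^+ 15 * (u * n1 / s) * Y <= 2 ^+ 15 * (f * Y).
  by rewrite -mulrA ler_wpM2l ?exprn_ge0 // ler_wpM2r //; move: Y1; lra.
have x4 : f <= f * Y by rewrite ler_peMr.
have x5 : n <= 14 * f + 2 ^+ 15 * (f * Y) + f + 1.
  by apply: le_trans nK _; move: Ka x1 x2 x3 af uf; lra.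
by move: x4 x5 f1; lra.
Qed.

(** A polynomial bound on [n] in terms of [f] lets [Y] stand for the logarithm of [n] in the union
    bound, so the block size can be fixed before [n]. *)
Lemma users_le_cube : n + 1 <= f ^+ 3.
Proof.
apply: le_trans users_le _.
have f1 : 2 ^+ 17 <= f.
  apply: le_trans a17 _; rewrite fE lerDl !mulr_ge0 ?invr_ge0 //.
    by move: a17 au; lra.
  by move: s1; lra.
have f0 : 0 <= f by lra.
have h : 2 ^+ 16 * Y <= f * f.
  by apply: ler_pM => //; move: Y1 f1; lra.
have := ler_wpM2l f0 h; lra.
Qed.

End parameters.

(** * Assembly of the theorem *)

Lemma achievable_weaken (d : measure_display) (Z : measurableType d) (O : finType)
    (R : realType) (T : task Z O R) m (eps delta gamma gamma' : R) n :
  gamma' <= gamma -> achievable T m eps delta gamma n ->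
  achievable T m eps delta gamma' n.
Proof.
move=> gg' [A [Adp Au]]; exists A; split => // D vD.
by apply: le_trans (Au D vD); rewrite lee_fin.
Qed.

Lemma num_users_attained (d : measure_display) (Z : measurableType d)
    (O : finType) (R : realType) (T : task Z O R) m (eps delta gamma : R) :
  num_users T m eps delta gamma = +oo%E \/
  exists n, achievable T m eps delta gamma n /\
    num_users T m eps delta gamma = n%:R%:E.
Proof.
have [[n an]|none] := pselect (exists n, achievable T m eps delta gamma n).
  right; have exn : exists n, `[< achievable T m eps delta gamma n >].
    by exists n; exact/asboolP.
  case: (ex_minnP exn) => k /asboolP ak kmin; exists k; split => //.
  by apply: num_users_min => // j aj; apply: kmin; exact/asboolP.
left; rewrite /num_users (_ : [set _ | _ in _] = set0) ?ereal_inf0 //.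
apply/seteqP; split => // x [n an _]; by apply: none; exists n.
Qed.

Lemma expR1_le4 (R : realType) : expR 1 <= 4 :> R.
Proof.
have : expR (1 / 2 : R) <= 1 + 1 / 2 + 2 * (1 / 2) ^+ 2.
  by apply: expR_le_quad; rewrite ger0_norm //; lra.
have := expR_gt0 (1 / 2 : R).
have -> : expR 1 = expR (1 / 2) * expR (1 / 2) :> R by rewrite -expRD; congr expR; lra.
by nra.
Qed.

Lemma ln_inv_ge1 (R : realType) (delta : R) : 0 < delta -> delta <= 2 ^- 17 ->
  1 <= ln delta^-1.
Proof.
move=> delta0 delta17; rewrite -ler_expR lnK ?posrE ?invr_gt0 //.
apply: le_trans (expR1_le4 R) _; apply: (@le_trans _ _ (2 ^+ 17)); first by lra.
by rewrite -[leLHS]invrK lef_pV2 ?posrE // invr_gt0 exprn_gt0.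
Qed.

(** The union bound has at most [expR (3 * K * Y)] terms. The coefficient 5 leaves at most
    [4 * expR (- 2 * Y)], which is at most [f^-1] since [f] is at least 4. *)
Lemma failure_le (R : realType) (Y f X : R) (K n : nat) :
  expR Y = f -> 4 <= f -> 0 <= Y -> 1 <= K%:R :> R -> n.+1%:R <= f ^+ 3 ->
  5 * (K%:R * Y) <= X -> (n.+1 ^ K)%:R * (4 * expR (- X)) <= f^-1.
Proof.
move=> expY f4 Y0 K1 nf X5.
have f0 : 0 < f by lra.
have h1 : (n.+1 ^ K)%:R <= expR (3 * (K%:R * Y)) :> R.
  have -> : expR (3 * (K%:R * Y)) = (f ^+ 3) ^+ K.
    by rewrite -expY -!expRM_natl mulrCA.
  by rewrite natrX lerXn2r ?nnegrE // exprn_ge0 // ltW.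
have h2 : 4 * expR (- X) <= 4 * expR (- (5 * (K%:R * Y))) :> R.
  by rewrite ler_pM2l // ler_expR lerN2.
apply: (@le_trans _ _ (expR (3 * (K%:R * Y)) * (4 * expR (- (5 * (K%:R * Y)))))).
  by apply: ler_pM => //; rewrite mulr_ge0 // expR_ge0.
rewrite mulrCA -expRD.
apply: (@le_trans _ _ (4 * expR (- Y - Y))).
  rewrite ler_pM2l // ler_expR.
  have := ler_wpM2r Y0 K1; rewrite mul1r; lra.
rewrite expRD expRN expY mulrA ler_piMl ?invr_ge0 ?(ltW f0) //.
by rewrite ler_pdivrMr // mul1r.
Qed.

Lemma expR_div_bounds (R : realType) (eps : R) (j : nat) : 0 <= eps <= 1 ->
  (1 < j)%N -> 1 <= expR (eps / j%:R) <= 2.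
Proof.
move=> /andP[eps0 eps1] j1; have j2 : 2 <= j%:R :> R by rewrite ler_nat.
have ej0 : 0 <= eps / j%:R by rewrite divr_ge0.
have ej1 : eps / j%:R <= 1 / 2 by rewrite ler_pdivrMr; lra.
rewrite -{1}expR0 ler_expR ej0 /=.
apply: (@le_trans _ _ (1 + eps / j%:R + 2 * (eps / j%:R) ^+ 2)); last by nra.
by apply: expR_le_quad; rewrite ger0_norm.
Qed.

Lemma exists_acceptance_expR (R : realType) (eps delta : R) (k : nat) :
  0 < eps <= 1 -> 0 < delta <= 2 ^- 17 ->
  6 * (ln delta^-1 / eps) <= k.+1%:R ->
  exists p : nat -> R,
   [/\ forall i, 0 <= p i <= 1, p 0 = 1, forall i, (k.+2 <= i)%N -> p i = 0 &
    forall i j, (i <= j.+1)%N -> (j <= i.+1)%N ->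
      p i <= expR (eps / 2) * p j + delta / 4 /\
      1 - p i <= expR (eps / 2) * (1 - p j) + delta / 4].
Proof.
move=> /andP[eps0 eps1] /andP[delta0 delta17] k1.
have /andP[e1 e2] : 1 <= expR (eps / 2) <= 2.
  by apply: expR_div_bounds => //; rewrite (ltW eps0).
(* The start costs [delta / 8 * expR (eps / 2)], at most [delta / 4]. At the other end, [k] makes
   the exponential at least [delta ^- 3], and [delta ^- 2 / 8] exceeds [4 / delta]. *)
apply: (@exists_acceptance _ _ _ (delta / 8)) => //.
- by rewrite divr_gt0.
- by have := ler_wpM2l (ltW delta0) e2; lra.
rewrite -expRM_natl; have expl : expR (ln delta^-1) = delta^-1.
  by rewrite lnK // posrE invr_gt0.
have h1 : (delta^-1) ^+ 3 <= expR (k.+1%:R * (eps / 2)).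
  rewrite -expl -expRM_natl ler_expR.
  have ea : eps * (ln delta^-1 / eps) = ln delta^-1.
    by rewrite mulrCA divff ?mulr1 // gt_eqF.
  by have := ler_wpM2l (ltW eps0) k1; rewrite mulrCA ea; lra.
have d8 : 0 <= delta / 8 by rewrite divr_ge0 // ltW.
apply: le_trans (ler_wpM2l d8 h1).
have di : 2 ^+ 17 <= delta^-1.
  by rewrite -[leLHS]invrK lef_pV2 ?posrE // invr_gt0 exprn_gt0.
have -> : (delta / 4)^-1 = 4 * delta^-1 by rewrite invfM invrK mulrC.
have -> : delta / 8 * delta^-1 ^+ 3 = delta^-1 ^+ 2 / 8.
  by field; rewrite gt_eqF.
by nra.
Qed.

(** Each of three nested sums at most triples the error, and the outer factor is at most 2. As
    [2 * 27 / 2 ^ 7] is below 1/2, the other half is left for the acceptance probabilities. *)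
Lemma privacy_budget (R : realType) (eps delta : R) : 0 <= eps <= 1 -> 0 <= delta ->
  let eh := expR (eps / 16) in let c := eh * (delta / 2 ^+ 7) + delta / 2 ^+ 7 in
  let e := eh * eh in
  expR (eps / 2) * (e * e * (e * c + c) + (e * c + c)) + 2 * (delta / 4) <= delta :> R.
Proof.
move=> eps01 delta0 /=.
have /andP[_ eh2] := expR_div_bounds eps01 (isT : (1 < 16)%N).
have /andP[_ e22] := expR_div_bounds eps01 (isT : (1 < 2)%N).
have /andP[_ e42] := expR_div_bounds eps01 (isT : (1 < 4)%N).
have /andP[_ e82] := expR_div_bounds eps01 (isT : (1 < 8)%N).
have -> : expR (eps / 16) * expR (eps / 16) = expR (eps / 8) :> R.
  by rewrite -expRD; congr expR; lra.
have -> : expR (eps / 8) * expR (eps / 8) = expR (eps / 4) :> R.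
  by rewrite -expRD; congr expR; lra.
have x0 : 0 <= delta / 2 ^+ 7 by rewrite divr_ge0 ?exprn_ge0.
set c := _ + delta / 2 ^+ 7.
have c3 : c <= 3 * (delta / 2 ^+ 7) by have := ler_wpM2r x0 eh2; rewrite /c; lra.
have c0 : 0 <= c by rewrite addr_ge0 // mulr_ge0 // expR_ge0.
clearbody c; set y := _ * c + c.
have y3 : y <= 3 * c by have := ler_wpM2r c0 e82; rewrite /y; lra.
have y0 : 0 <= y by rewrite addr_ge0 // mulr_ge0 // expR_ge0.
clearbody y; set z := _ * y + y.
have z3 : z <= 3 * y by have := ler_wpM2r y0 e42; rewrite /z; lra.
have z0 : 0 <= z by rewrite addr_ge0 // mulr_ge0 // expR_ge0.
clearbody z; have := ler_wpM2r z0 e22; lra.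
Qed.

(** Acceptance vanishes from [k.+2] on, and [K] must hold two deleted sets, hence the doubling.
    Acceptance takes [eps / 2], and the comparisons take eight times [eps / 16]. *)
Lemma item_to_user (d : measure_display) (Z : measurableType d) (R : realType)
    (O : finType) (T : task Z O R) (gamma eps delta delta' : R)
    (m n1 n b k : nat) (K := (k.+2).*2) :
  0 < eps <= 2 ^- 17 -> 0 < delta <= 2 ^- 17 -> (0 < m)%N -> (0 < b)%N ->
  0 <= delta' -> achievable T 1 eps delta' gamma n1 ->
  6 * (ln delta^-1 / eps) <= k.+1%:R ->
  (n1 * b + K * m <= n * m)%N ->
  (2 ^+ 9 * ln delta^-1) ^+ 2 * (K * m)%:R <= b%:R ^+ 2 ->
  (K * m)%:R * delta' <= delta / 2 ^+ 13 ->
  achievable T m eps delta (gamma - (n.+1 ^ K)%:R *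
    (4 * expR (- ((b %/ 64)%:R ^+ 2 / (16 * (K * m)%:R))))) n.
Proof.
move=> /andP[eps0 eps17] /andP[delta0 delta17] m0 b0 delta'0 [A [Adp Au]].
move=> k1 room bm Kd.
have eps1 : eps <= 1 / 2 by move: eps17; lra.
have eps01 : 0 <= eps <= 1 by rewrite (ltW eps0) /=; lra.
have [||p [p01 p0 pk pstep]] := exists_acceptance_expR _ _ k1.
- by rewrite eps0; lra.
- by rewrite delta0.
rewrite -[n1]muln1 in room.
have /andP[eh1 _] := expR_div_bounds eps01 (isT : (1 < 16)%N).
have /andP[e21 _] := expR_div_bounds eps01 (isT : (1 < 2)%N).
have x0 : 0 <= delta / 2 ^+ 7 by rewrite divr_ge0 ?exprn_ge0 // ltW.
have c0 : 0 <= expR (eps / 16) * (delta / 2 ^+ 7) + delta / 2 ^+ 7.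
  by rewrite addr_ge0 // mulr_ge0 // expR_ge0.
have d20 : 0 <= delta / 4 by rewrite divr_ge0 // ltW.
have beta0 : 0 <= 4 * expR (- ((b %/ 64)%:R ^+ 2 / (16 * (K * m)%:R))) :> R.
  by rewrite mulr_ge0 // expR_ge0.
have Km0 : (0 < K * m)%N by rewrite muln_gt0 m0.
have dl : delta * expR (ln delta^-1) = 1.
  by rewrite lnK ?posrE ?invr_gt0 // mulfV // gt_eqF.
apply: (transfer m0 b0 (ltW eps0) Adp Au room (mulr_ege1 eh1 eh1) c0 beta0 _
  e21 d20 p01 p0 pk (leqnn _) pstep).
- move=> s F sK F0 F1 Fdp.
  apply: (cube_concentration (delta' := delta') (l := ln delta^-1)) => //.
  + by rewrite eps0.
  + by rewrite delta0 /=; move: delta17; lra.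
  + exact: ln_inv_ge1.
- by rewrite -!expRD ler_expR; lra.
- exact: privacy_budget eps01 (ltW delta0).
Qed.

Section main_bound.
Context (d : measure_display) (Z : measurableType d) (R : realType) (O : finType).
Context (T : task Z O R) (gamma eps delta : R) (m n1 : nat).
Hypotheses (eps0 : 0 < eps) (eps17 : eps <= 2 ^- 17).
Hypotheses (delta0 : 0 < delta) (delta17 : delta <= 2 ^- 17) (m0 : (0 < m)%N).
Let l := ln delta^-1.
Let delta' := 2 ^- 20 * (delta * (eps / (m%:R * l))).
Hypothesis item : achievable T 1 eps delta' gamma n1.
Let f := l / eps + (Num.sqrt m%:R)^-1 * (l `^ (3 / 2) / eps) * n1%:R.

Let l1 : 1 <= l. Proof. exact: ln_inv_ge1. Qed.

Let a17 : 2 ^+ 17 <= l / eps.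
Proof.
rewrite ler_pdivlMr //; apply: le_trans l1.
apply: le_trans (ler_wpM2l _ eps17) _; first exact: exprn_ge0.
by rewrite mulfV // expf_neq0.
Qed.

Lemma main_bound : exists n, (n%:R <= 2 ^+ 16 * f * ln f ^+ 1) /\
  achievable T m eps delta (gamma - f^-1) n.
Proof.
pose a := l / eps; pose s : R := Num.sqrt m%:R; pose u := l `^ (3 / 2) / eps.
have lw : l <= l `^ (3 / 2).
  by rewrite -[leLHS]powRr1 ?ler_powR //; move: l1; lra.
have uu : u ^+ 2 = l * a ^+ 2.
  rewrite /u /a !expr_div_n mulrA -exprS; congr (_ / _).
  have l0 : 0 <= l by move: l1; lra.
  rewrite -(powR_mulrn 2 (powR_ge0 _ _)) -powRrM -(powR_mulrn 3 l0).
  by congr powR; lra.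
have au : a <= u by rewrite ler_wpM2r // invr_ge0 ltW.
have m1 : 1 <= m%:R :> R by rewrite ler1n.
have s1 : 1 <= s by rewrite -sqrtr1 ler_sqrt.
have sm : s ^+ 2 = m%:R by rewrite sqr_sqrtr.
have fE : f = a + u * n1%:R / s by rewrite /f -/s -/u -/a [s^-1 * u]mulrC mulrAC.
have eps1 : eps <= 1 / 2 by move: eps17; lra.
have la : l <= a by rewrite ler_pdivlMr // ler_piMr //; move: l1; lra.
have s0 : 0 < s by lra.
have a0 : 0 < a by move: a17; rewrite -/a; lra.
have u0 : 0 <= u by exact: le_trans (ltW a0) au.
have af : a <= f.
  rewrite fE lerDl; apply: mulr_ge0; last by rewrite invr_ge0 ltW.
  exact: mulr_ge0.
have f17 : 2 ^+ 17 <= f by exact: le_trans af.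
have f0 : 0 < f by lra.
pose Y := ln f.
have expY : expR Y = f by rewrite lnK.
have Y1 : 1 <= Y.
  by rewrite -ler_expR expY; apply: le_trans (expR1_le4 R) _; lra.
have Yf : Y <= f by rewrite -expY; have := expR_ge1Dx Y; lra.
pose k0 := Num.truncn (6 * a).
have k01 : 6 * a <= k0.+1%:R by rewrite ltW // truncnS_gt.
have k02 : k0%:R <= 6 * a by rewrite truncn_le; lra.
pose K := (k0.+2).*2.
have KR : K%:R = 2 * (k0%:R + 2) :> R by rewrite /K -mul2n natrM -[k0.+2]addn2 natrD.
have K1 : 1 <= K%:R :> R by rewrite ler1n.
have Ka : K%:R <= 14 * a by rewrite KR; move: a17; rewrite -/a; lra.
(* The factor [s * u] makes [n1 * b / m] match the second term of [f], up to the logarithm [Y]. *)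
pose b := (Num.truncn (2 ^+ 15 * (s * u * Y))).+1.
have b1 : 2 ^+ 15 * (s * u * Y) <= b%:R by rewrite ltW // truncnS_gt.
have b2 : b%:R <= 2 ^+ 15 * (s * u * Y) + 1.
  rewrite /b -natr1 lerD2r truncn_le; apply: mulr_ge0; first exact: exprn_ge0.
  by apply: mulr_ge0; [exact: mulr_ge0 (ltW s0) u0|lra].
(* [K] users' worth of spare data for replacements, and enough further users to fill [n1] blocks. *)
pose n := (K + ((n1 * b) %/ m).+1)%N.
have nK : n%:R <= K%:R + n1%:R * b%:R / m%:R + 1 :> R.
  have h : ((n1 * b) %/ m)%:R <= n1%:R * b%:R / m%:R :> R.
    by rewrite ler_pdivlMr ?ltr0n // -!natrM ler_nat leq_trunc_div.
  by rewrite /n natrD -addn1 natrD; lra.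
have bm := block_size_moment l1 a17 la au uu s1 sm Y1 K1 Ka b1.
have r1 : b%:R / 2 ^+ 7 <= (b %/ 64)%:R :> R.
  have b64 : (64 <= b)%N.
    rewrite -(ler_nat R); apply: le_trans b1; have : 1 <= s * u * Y; last by lra.
    have u1 : 1 <= u by apply: le_trans (le_trans a17 au); lra.
    by apply: mulr_ege1 => //; exact: mulr_ege1.
  have rb : (b <= 128 * (b %/ 64))%N by move: b64; clear; lia.
  rewrite ler_pdivrMr ?exprn_gt0 //.
  by rewrite -(ler_nat R) natrM in rb; lra.
have br := blowup_radius l1 a17 au uu s1 sm Y1 K1 Ka b1 r1.
have nf := users_le a17 au s1 sm (ler0n R n1) fE Y1 Ka b2 nK.
have nf3 := users_le_cube a17 au s1 sm (ler0n R n1) fE Y1 Yf Ka b2 nK.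
exists n; split; first by rewrite expr1 -/Y; lra.
have room : (n1 * b + K * m <= n * m)%N.
  by rewrite /n mulnDl addnC leq_add2l ltnW // ltn_ceil.
have delta'0 : 0 <= delta'.
  rewrite mulr_ge0 ?invr_ge0 ?exprn_ge0 // mulr_ge0 ?(ltW delta0) //.
  by rewrite divr_ge0 ?(ltW eps0) // mulr_ge0 //; move: l1; lra.
(* [delta'] carries [m * l / eps] in its denominator, which cancels [K * m] because [K] is at most
   [14 * a]. *)
have Kd : (K * m)%:R * delta' <= delta / 2 ^+ 13.
  have -> : (K * m)%:R * delta' = K%:R / a * (delta / 2 ^+ 20).
    rewrite natrM /delta' /a; field.
    by rewrite !gt_eqF //; move: l1; lra.
  have d20 : 0 <= delta / 2 ^+ 20 by rewrite divr_ge0 ?exprn_ge0 // ltW.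
  apply: (@le_trans _ _ (14 * (delta / 2 ^+ 20))).
    by rewrite ler_wpM2r // ler_pdivrMr.
  by move: delta0; lra.
apply: (achievable_weaken _ (item_to_user _ _ m0 _ delta'0 item k01 room _ Kd)) => //.
- rewrite lerD2l lerN2; apply: (failure_le (Y := Y)) => //.
  + by move: f17; lra.
  + by move: Y1; lra.
  + by rewrite -natr1.
  + by rewrite natrM.
- by rewrite eps0.
- by rewrite delta0.
- by rewrite natrM.
Qed.

End main_bound.

Theorem theorem3p2 (R : realType) :
  exists (c0 c1 c2 C : R) (k : nat) (eta : R -> R),
    [/\ 0 < c0, 0 < c1, 0 < c2, 0 < C & eta r @[r --> +oo] --> (0 : R)] /\
    forall (d : measure_display) (Z : measurableType d) (O : finType)
      (T : task Z O R) (gamma : R), 0 < gamma ->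
    forall (eps delta : R) (m : nat),
      0 < eps <= c0 -> 0 < delta <= c0 -> (0 < m)%N ->
    exists delta' : R,
      let q := delta * (eps / (m%:R * ln (delta^-1))) in
      let f := users_bound m eps delta (num_users T 1 eps delta' gamma) in
      c1 * q <= delta' <= c2 * q /\
      (num_users T m eps delta (gamma - eta (fine f)) <= soft_O C k f)%E.
Proof.
(* As [delta'] is taken equal to [2 ^- 20 * q], both Theta constants coincide. The vanishing loss in
   usefulness is [f^-1]. *)
exists (2 ^- 17), (2 ^- 20), (2 ^- 20), (2 ^+ 16), 1%N, (fun r => r^-1).
split.
  split; rewrite ?invr_gt0 ?exprn_gt0 //.
  apply/(@gtr0_cvgV0 _ _ _ _ id); last exact: cvg_id.
  exact: nbhs_pinfty_gt.
move=> d Z O T gamma _ eps delta m /andP[eps0 eps17] /andP[delta0 delta17] m0.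
exists (2 ^- 20 * (delta * (eps / (m%:R * ln delta^-1)))) => q f.
split; first by rewrite lexx.
(* If the item-level complexity is infinite, so is the bound, since its coefficient there is
   positive. *)
have [noo|[n1 [an1 nE]]] := num_users_attained T 1 eps
    (2 ^- 20 * (delta * (eps / (m%:R * ln delta^-1)))) gamma.
  have l1 := ln_inv_ge1 delta0 delta17.
  have u0 : 0 < (Num.sqrt m%:R)^-1 * (ln delta^-1 `^ (3 / 2) / eps).
    rewrite mulr_gt0 ?invr_gt0 ?sqrtr_gt0 ?ltr0n // divr_gt0 // powR_gt0 //.
    by move: l1; lra.
  by rewrite /f noo /users_bound gt0_muley ?lte_fin //= leey.
rewrite /f nE /users_bound -EFinM -EFinD /=.
have [n [nle an]] := main_bound eps0 eps17 delta0 delta17 m0 an1.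
apply: (@le_trans _ _ n%:R%:E); last by rewrite lee_fin.
by apply: ereal_inf_lbound; exists n.
Qed.
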